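(* Let $m\ge3$ and let $u$ be a quasi-harmonic function on $\mathbb{R}^m$. Suppose there exist constants $C>0$ and $\epsilon>0$ and a sequence $r_i\to+\infty$ such that for all $i$ $$\Big(\int_{S^{m-1}}u(r_i,\theta)^2\,d\theta\Big)^{\frac12}\le C e^{\frac{r_i^2}{4}}r_i^{-(m+\epsilon)}.$$ Then $u$ is a constant.
   Context: $(r,\theta)\in(0,\infty)\times S^{m-1}$ are spherical coordinates on $\mathbb{R}^m$, and $d\theta$ is the standard measure on the unit sphere. On $\mathbb{R}^m$, $m\ge3$, consider the metric $g=e^{-\frac{|x|^2}{2(m-2)}}ds_0^2$, where $ds_0^2$ is the Euclidean metric; its Laplacian is $\Delta_g=e^{\frac{|x|^2}{2(m-2)}}(\Delta-\nabla h\cdot\nabla)$ with $h=\frac{|x|^2}{4}$ and $\Delta,\nabla$ Euclidean. A function $u$ is quasi-harmonic if $\Delta_g u=0$, equivalently $\Delta u-\frac r2\frac{\partial u}{\partial r}=0$. *)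

(* Defs.v *)
From HB Require Import structures.
From mathcomp Require Import all_boot all_order all_algebra.
From mathcomp Require Import all_classical all_reals all_analysis.
From mathcomp Require Import measurable_realfun ring lra.

Set Implicit Arguments.
Unset Strict Implicit.
Unset Printing Implicit Defensive.

Import Order.TTheory GRing.Theory Num.Theory.
Import numFieldNormedType.Exports.

Local Open Scope classical_set_scope.
Local Open Scope ring_scope.

(* The library norm on 'rV[R]_m is the sup norm, hence this definition. *)
Definition enorm (R : realType) (m : nat) (x : 'rV[R]_m) : R :=
  Num.sqrt (\sum_i x 0 i ^+ 2).

Definition partial (R : realType) (m : nat) (i : 'I_m) (u : 'rV[R]_m -> R)
    : 'rV[R]_m -> R :=
  fun x => 'D_(delta_mx 0 i) u x.

Fixpoint Ck (R : realType) (m k : nat) (u : 'rV[R]_m -> R) : Prop :=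
  continuous u /\
  (if k is k'.+1 then
     forall i, (forall x, derivable u x (delta_mx 0 i)) /\ Ck k' (partial i u)
   else True).

(* A metric on R^m is given by its matrix field G in Cartesian coordinates;
   Delta_G u = |G|^{-1/2} d_i (|G|^{1/2} G^{ij} d_j u). *)
Definition laplace_beltrami (R : realType) (m : nat) (G : 'rV[R]_m -> 'M[R]_m)
    (u : 'rV[R]_m -> R) : 'rV[R]_m -> R :=
  fun x => (Num.sqrt (\det (G x)))^-1 *
    \sum_i partial i (fun y => Num.sqrt (\det (G y)) *
                        \sum_j invmx (G y) i j * partial j u y) x.

Definition qh_metric (R : realType) (m : nat) (x : 'rV[R]_m) : 'M[R]_m :=
  (expR (- (enorm x ^+ 2 / (2 * (m%:R - 2)))))%:M.

Definition quasi_harmonic (R : realType) (m : nat) (u : 'rV[R]_m -> R) : Prop :=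
  Ck 2 u /\ forall x, laplace_beltrami (@qh_metric R m) u x = 0.


Section laplace_beltrami_qh_metric.
Context (R : realType) (m : nat).
Implicit Types (x : 'rV[R]_m).

Let h x : R := enorm x ^+ 2 / 4.

Let enorm2E x : enorm x ^+ 2 = \sum_i x 0 i ^+ 2.
Proof. by rewrite sqr_sqrtr// sumr_ge0// => i _; rewrite sqr_ge0. Qed.

Let diff_h x : differentiable h x.
Proof.
rewrite (_ : h = \sum_i (fun y : 'rV[R]_m => 4^-1 *: (y 0 i * y 0 i))); last first.
  apply/funext => y; rewrite /h enorm2E fct_sumE mulr_suml.
  by apply: eq_bigr => i _; rewrite mulrC expr2.
apply: differentiable_sum => i; apply: differentiableZ.
by apply: differentiableM; exact: differentiable_coord.
Qed.

Let w x : R := expR (- h x).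

Let diff_w x : differentiable w x.
Proof.
apply: (@differentiable_comp _ _ _ _ (\- h) expR); first exact: differentiableN.
exact/derivable1_diffP.
Qed.

Let partial_w i x : partial i w x = - (w x * partial i h x).
Proof.
rewrite /partial deriveE// (_ : w = expR \o (\- h))//.
have dexp : differentiable (@expR R) ((\- h) x) by exact/derivable1_diffP.
rewrite diff_comp//; last exact: differentiableN.
rewrite /= diff1E// derive1E [X in _ *: X]derive_val diffN// deriveE//.
by rewrite -[LHS]/(- _ * _) mulNr mulrC.
Qed.

Lemma laplace_beltrami_qh_metricE (u : 'rV[R]_m -> R) x :
  (2 < m)%N -> Ck 2 u ->
  laplace_beltrami (@qh_metric R m) u x =
  expR (enorm x ^+ 2 / (2 * (m%:R - 2))) *
  (\sum_i partial i (partial i u) x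
   - \sum_i partial i (fun y => enorm y ^+ 2 / 4) x * partial i u x).
Proof.
move=> m2 [_ C2u].
have m20 : m%:R - 2 != 0 :> R by rewrite subr_eq0 eqr_nat gtn_eqF.
pose s (y : 'rV[R]_m) : R := enorm y ^+ 2 / (2 * (m%:R - 2)).
have sqrt_det y : Num.sqrt (\det (@qh_metric R m y)) = expR (- (m%:R * s y / 2)).
  rewrite det_scalar -expRM_natl -/(s y).
  rewrite (_ : expR _ = expR (- (m%:R * s y / 2)) ^+ 2).
    by rewrite sqrtr_sqr ger0_norm// expR_ge0.
  by rewrite -expRM_natl; congr expR; field.
rewrite /laplace_beltrami sqrt_det.
under eq_bigr => i _.
  rewrite (_ : (fun y => _) = w * partial i u); last first.
    apply/funext => y; rewrite sqrt_det /qh_metric invmx_scalar -/(s y).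
    rewrite (bigD1 i)//= big1 ?addr0; last first.
      by move=> j ji; rewrite !mxE eq_sym (negPf ji) mulr0n mul0r.
    rewrite !mxE eqxx mulr1n -expRN opprK mulrA -expRD; congr (expR _ * _).
    by rewrite /s /h; field.
  have [_ [_ C1i]] := C2u i; have [dui _] := C1i i.
  rewrite /partial deriveM//; last exact: diff_derivable.
  rewrite -!/(partial _ _ _) partial_w.
  rewrite (_ : _ + _ = w x * (partial i (partial i u) x
                              - partial i h x * partial i u x)); last first.
    by rewrite /GRing.scale/=; ring.
  over.
rewrite -mulr_sumr sumrB mulrA -expRN opprK /w -expRD; congr (expR _ * _).
by rewrite /s /h; field.
Qed.

End laplace_beltrami_qh_metric.

(* The library has Borel sets on m.-tuple R but not on 'rV[R]_m. *)
Definition row_of_tuple (R : realType) (m : nat)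
    (t : m.-tuple (measurableTypeR R)) : 'rV[R]_m :=
  \row_i tnth t i.

Fixpoint lebesgue_tuple (R : realType) (n : nat) {struct n} :
    set (n.-tuple (measurableTypeR R)) -> \bar R :=
  match n with
  | 0 => dirac [tuple]
  | n'.+1 => pushforward
      (product_measure1 (@lebesgue_measure R) (@lebesgue_tuple R n'))
      (fun p => [tuple of p.1 :: p.2])
  end.

Section lebesgue_tuple_measure.
Context (R : realType).
Local Notation T := (measurableTypeR R).

Let cons_tuple n (p : T * n.-tuple T) : n.+1.-tuple T := [tuple of p.1 :: p.2].

Let uncons_tuple n (t : n.+1.-tuple T) : T * n.-tuple T :=
  (thead t, [tuple of behead t]).

Let measurable_cons_tuple n : measurable_fun setT (@cons_tuple n).
Proof. exact: measurable_cons. Qed.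

Let measurable_uncons_tuple n : measurable_fun setT (@uncons_tuple n).
Proof.
apply: measurable_fun_pair; [exact: measurable_tnth|exact: measurable_behead].
Qed.

Let cons_tupleK n : cancel (@cons_tuple n) (@uncons_tuple n).
Proof. by case=> x t; congr pair; exact: val_inj. Qed.

Let uncons_tupleK n : cancel (@uncons_tuple n) (@cons_tuple n).
Proof. by move=> t; rewrite [RHS]tuple_eta. Qed.

Let set_fun_sigma_finite_measure d (U : measurableType d)
    (nu : set U -> \bar R) : nu set0 = 0%E -> (forall A, (0 <= nu A)%E) ->
  semi_sigma_additive nu -> sigma_finite setT nu ->
  exists mu : {sigma_finite_measure set U -> \bar R}, mu = nu :> (set _ -> _).
Proof.
move=> nu0 nuge0 nusa nusf.
pose h0 := isMeasure.Build _ _ _ nu nu0 nuge0 nusa.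
pose nu' : {measure set U -> \bar R} := HB.pack nu h0.
pose h1 := Measure_isSigmaFinite.Build _ _ _ nu' nusf.
pose nu'' : {sigma_finite_measure set U -> \bar R} := HB.pack nu h0 h1.
by exists nu''.
Qed.

Let lebesgue_tuple_ex n :
  exists mu : {sigma_finite_measure set (n.-tuple T) -> \bar R},
  mu = @lebesgue_tuple R n :> (set _ -> _).
Proof.
elim: n => [|n [mu muE]].
  by exists (\d_([tuple] : 0.-tuple T)).
pose pm := lebesgue_integral_fubini_product_measure1__canonical__measure_function_Measure
  (@lebesgue_measure R) mu.
pose f := @cons_tuple n.
pose nu := pushforward pm f.
have nu0 : nu set0 = 0%E by rewrite /nu /pushforward preimage_set0 measure0.
have nuge0 A : (0 <= nu A)%E by exact: (@measure_ge0 _ _ _ pm).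
have nusa : semi_sigma_additive nu.
  pose p := measure_function_pushforward__canonical__measure_function_Measure
    pm (@measurable_cons_tuple n).
  exact: (@measure_semi_sigma_additive _ _ _ p).
have nusf : sigma_finite setT nu.
  have /sigma_finiteP[F [TF ndF Foo]] := sigma_finiteT (@lebesgue_measure R).
  have /sigma_finiteP[G [TG ndG Goo]] := sigma_finiteT mu.
  exists (fun k => @uncons_tuple n @^-1` (F k `*` G k)).
    rewrite -preimage_bigcup -[LHS](preimage_setT (@uncons_tuple n)).
    congr (_ @^-1` _); rewrite -setXTT TF TG predeqE => -[x y]; split.
      move=> [/= [i _ Fix] [k _ Gky]]; exists (maxn i k) => //; split.
      - by move: x Fix; exact/subsetPset/ndF/leq_maxl.
      - by move: y Gky; exact/subsetPset/ndG/leq_maxr.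
    by move=> [k _ []/= ? ?]; split; exists k.
  move=> k; have [mF Fk] := Foo k; have [mG Gk] := Goo k; split.
    rewrite -[X in measurable X]setTI; apply: measurable_uncons_tuple => //.
    exact: measurableX.
  rewrite /nu /pushforward -comp_preimage (_ : _ \o _ = id).
    rewrite preimage_id/= product_measure1E//.
    by rewrite lte_mul_pinfty// ge0_fin_numE.
  by apply/funext => p /=; rewrite cons_tupleK.
have [m' m'E] := set_fun_sigma_finite_measure nu0 nuge0 nusa nusf.
by exists m'; rewrite m'E /nu /= -muE.
Qed.

Section instance.
Context (n : nat).

Let lebesgue_tuple0 : @lebesgue_tuple R n set0 = 0%E.
Proof. by have [mu <-] := lebesgue_tuple_ex n; exact: measure0. Qed.

Let lebesgue_tuple_ge0 A : (0 <= @lebesgue_tuple R n A)%E.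
Proof. by have [mu <-] := lebesgue_tuple_ex n; exact: measure_ge0. Qed.

Let lebesgue_tuple_semi_sigma_additive :
  semi_sigma_additive (@lebesgue_tuple R n).
Proof.
by have [mu <-] := lebesgue_tuple_ex n; exact: measure_semi_sigma_additive.
Qed.

Let lebesgue_tuple_sigma_finite : sigma_finite setT (@lebesgue_tuple R n).
Proof. by have [mu <-] := lebesgue_tuple_ex n; exact: sigma_finiteT. Qed.

HB.instance Definition _ := isMeasure.Build _ _ _ (@lebesgue_tuple R n)
  lebesgue_tuple0 lebesgue_tuple_ge0 lebesgue_tuple_semi_sigma_additive.

HB.instance Definition _ := Measure_isSigmaFinite.Build _ _ _
  (@lebesgue_tuple R n) lebesgue_tuple_sigma_finite.

End instance.
End lebesgue_tuple_measure.

Definition unit_sphere (R : realType) (m : nat)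
    : set (m.-tuple (measurableTypeR R)) :=
  [set t | enorm (row_of_tuple t) = 1].

Definition punctured_unit_ball (R : realType) (m : nat)
    : set (m.-tuple (measurableTypeR R)) :=
  [set t | 0 < enorm (row_of_tuple t) <= 1].

Definition direction (R : realType) (m : nat)
    (t : m.-tuple (measurableTypeR R)) : m.-tuple (measurableTypeR R) :=
  [tuple tnth t i / enorm (row_of_tuple t) | i < m].

(* The standard surface measure on the sphere, as cone measure: by polar coordinates
   dx = r^{m-1} dr dtheta, the cone {r theta | 0 < r <= 1, theta in A} has
   volume |A| / m. *)
Definition sphere_measure (R : realType) (m : nat)
    (A : set (m.-tuple (measurableTypeR R))) : \bar R :=
  (m%:R%:E * lebesgue_tuple (@direction R m @^-1` A `&`
                             @punctured_unit_ball R m))%E.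

Section sphere_measure_instance.
Context (R : realType) (m : nat).
Local Notation T := (measurableTypeR R).

Let measurable_enorm :
  measurable_fun setT (fun t : m.-tuple T => enorm (row_of_tuple t)).
Proof.
rewrite /enorm; apply: (@measurableT_comp _ _ _ _ _ _ (@Num.sqrt R)).
  exact: (continuous_measurable_fun (@sqrt_continuous R)).
apply: measurable_sum => i.
rewrite (_ : (fun t => _) = (fun t => tnth t i ^+ 2)); last first.
  by apply/funext => t; rewrite mxE.
by apply: measurable_funX; exact: measurable_tnth.
Qed.

Let measurable_ball : measurable (@punctured_unit_ball R m).
Proof.
rewrite (_ : @punctured_unit_ball R m =
  (fun t : m.-tuple T => enorm (row_of_tuple t)) @^-1` `]0, 1]).
  by rewrite -[X in measurable X]setTI; exact: measurable_enorm.
by apply/seteqP; split=> t; rewrite /= in_itv.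
Qed.

Let measurable_direction : measurable_fun setT (@direction R m).
Proof.
apply/measurable_fun_tnthP => i.
rewrite (_ : _ \o _ = fun t => tnth t i * enorm (row_of_tuple t) `^ (-1)).
  apply: measurable_funM; first exact: measurable_tnth.
  apply: (@measurableT_comp _ _ _ _ _ _ (fun x : R => x `^ (-1))) => //.
by apply/funext => t /=; rewrite tnth_mktuple powR_inv1// sqrtr_ge0.
Qed.

Let sphere_measureE : @sphere_measure R m =
  pushforward (mscale (NngNum (ler0n R m))
    (mrestr (@lebesgue_tuple R m) measurable_ball)) (@direction R m).
Proof. by []. Qed.

Let sphere_measure0 : @sphere_measure R m set0 = 0%E.
Proof. by rewrite sphere_measureE /pushforward preimage_set0 measure0. Qed.

Let sphere_measure_ge0 A : (0 <= @sphere_measure R m A)%E.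
Proof. by rewrite sphere_measureE; exact: measure_ge0. Qed.

Let sphere_measure_semi_sigma_additive :
  semi_sigma_additive (@sphere_measure R m).
Proof.
pose p := measure_function_pushforward__canonical__measure_function_Measure
  (mscale (NngNum (ler0n R m))
    (mrestr (@lebesgue_tuple R m) measurable_ball)) measurable_direction.
exact: (@measure_semi_sigma_additive _ _ _ p).
Qed.

HB.instance Definition _ := isMeasure.Build _ _ _ (@sphere_measure R m)
  sphere_measure0 sphere_measure_ge0 sphere_measure_semi_sigma_additive.

End sphere_measure_instance.

(* Main.v *)
(* Write [A(f, r)] for the integral of [x |-> f (r x)] over the unit sphere, and put
   [I = A(u^2, r)], [K = A(u u_r, r) = I'/2], [Q = A(u_r^2, r)] and
   [P = r^(m-1) e^(-r^2/4)]. The rotation fields [L = x_i d_j - x_j d_i] are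
   skew-adjoint for the sphere measure, so [A(u L^2 u, r) <= 0]; since the equation
   expresses [u_rr] through [u_r] and the [L^2 u], this yields [(P K)' >= P Q >= 0].
   If [u] is not constant then [Q > 0] somewhere, hence [P K > 0] from some radius on;
   by the Cauchy-Schwarz inequality [K^2 <= I Q], the function [P (sqrt I)'] is
   nondecreasing there, so [(sqrt I)' >= c r^(1-m) e^(r^2/4)] with [c > 0], and
   [sqrt I] grows at least like [r^(-m) e^(r^2/4)]. *)

Require Import Defs.
From mathcomp Require Import all_boot all_order all_algebra.
From mathcomp Require Import all_classical all_reals all_analysis.
From mathcomp Require Import measurable_realfun ring lra.

Import Order.TTheory GRing.Theory Num.Theory.
Import numFieldNormedType.Exports.

Local Open Scope classical_set_scope.
Local Open Scope ring_scope.

Set Implicit Arguments.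
Unset Strict Implicit.
Unset Printing Implicit Defensive.

(** * Row vectors: topology and the chain rule *)

(** Skew-adjointness is obtained from symmetry rather than from charts: the integral of [u L u] over
    a sphere does not change when the argument is rotated, and differentiating in the angle at 0
    shows that [(L u)^2 + u L^2 u] has integral 0. Invariance of the cone measure is traced back to
    the Lebesgue measure on tuples, an iterated product; there the accessible symmetries are shears
    moving one coordinate, and rotations are composed from these. The equation enters through the
    identity that the [L_ij^2], summed over ordered pairs, give
    [2 (r^2 Delta - r^2 d_r^2 - (m-1) r d_r)]. The weight [P] is the integrating factor of the
    resulting first-order relation for [K], since [P'/P = (m-1)/r - r/2]; it vanishes at 0, so [P K]
    starts from 0 and a single radius with [Q > 0] makes it positive afterwards. As [u] is only
    [C^2], in the sense of partial derivatives, every derivative is expanded into first and second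
    partials, and differentiation along rays and rotation orbits rests on a chain rule derived from
    continuity of the partials. *)

Lemma continuous_pair (T U V : topologicalType) (f : T -> U) (g : T -> V) :
  continuous f -> continuous g -> continuous (fun x => (f x, g x)).
Proof. by move=> cf cg x; exact: (cvg_pair (cf x) (cg x)). Qed.

Lemma continuous_comp_fun (T U V : nbhsType) (f : T -> U) (g : U -> V) :
  continuous f -> continuous g -> continuous (fun x => g (f x)).
Proof. by move=> cf cg x; exact: (cvg_comp _ _ (cf x) (cg _)). Qed.

Section row_topology.
Context (R : realType) (m : nat).

Lemma coord_le_norm (x : 'rV[R]_m) i : `|x 0 i| <= `|x|.
Proof.
by rewrite [leRHS]/Num.norm/= mx_normrE (le_bigmax _ _ (0 : 'I_1, i)).
Qed.

Lemma row_norm_le (x : 'rV[R]_m) e :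
  0 <= e -> (forall i, `|x 0 i| <= e) -> `|x| <= e.
Proof.
move=> e0 xe; rewrite [leLHS]/Num.norm/= mx_normrE; apply/bigmax_leP; split => //.
by move=> [i j] _; rewrite /= ord1.
Qed.

Lemma cvg_row T (F : set_system T) (f : T -> 'rV[R]_m) (x : 'rV[R]_m) :
  Filter F -> (forall i, f t 0 i @[t --> F] --> x 0 i) -> f @ F --> x.
Proof.
move=> FF fx; apply/cvgrPdist_le => e e0.
have H i : \forall t \near F, `|x 0 i - f t 0 i| <= e.
  by move: e e0; apply/cvgrPdist_le/fx.
near=> t; apply: row_norm_le => [|i]; first exact: ltW.
by rewrite !mxE; move: i; near: t; apply: filter_forall.
Unshelve. all: by end_near. Qed.

Lemma continuous_row (T : topologicalType) (f : T -> 'rV[R]_m) :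
  (forall i, continuous (fun t => f t 0 i)) -> continuous f.
Proof. by move=> cf t; apply: cvg_row => i; exact: cf. Qed.

Definition cube (a : R) : set 'rV[R]_m := [set x | forall i, `|x 0 i| <= a].

Lemma compact_cube a : compact (cube a).
Proof.
rewrite (_ : cube a = [set v : 'rV[R]_m | forall i, `[- a, a]%classic (v ord0 i)]).
  by apply: (@rV_compact R m (fun=> `[- a, a]%classic)) => _; exact: segment_compact.
by apply/seteqP; split => x /= H i; move: (H i); rewrite in_itv/= ler_norml.
Qed.

(** The unit sphere lies in [cube 1], so this bounds continuous integrands on it, uniformly in a
    parameter [t] as domination requires. *)
Lemma continuous_cube_bounded (f : R * 'rV[R]_m -> R) (a b c : R) :
  continuous f -> exists M, forall t x, a <= t <= b -> cube c x -> `|f (t, x)| <= M.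
Proof.
move=> cf.
have : compact (f @` (`[a, b]%classic `*` cube c)).
  apply: continuous_compact; first exact: continuous_subspaceT.
  by apply: compact_setX; [exact: segment_compact|exact: compact_cube].
move=> /(@compact_bounded R R^o)[M [_ HM]]; exists (M + 1) => t x tab cx.
apply: (HM (M + 1)); first by rewrite ltrDl.
by exists (t, x) => //; split => //=; rewrite in_itv.
Qed.

End row_topology.

Lemma cvg_fct_sum (R : realType) T (F : set_system T) (I : Type) (s : seq I)
    (f : I -> T -> R) (l : I -> R) {FF : Filter F} :
  (forall i, f i @ F --> l i) ->
  \sum_(i <- s) f i t @[t --> F] --> \sum_(i <- s) l i.
Proof.
move=> fl; elim: s => [|i s IH].
  by rewrite big_nil; under eq_fun do rewrite big_nil; exact: cvg_cst.
by rewrite big_cons; under eq_fun do rewrite big_cons; exact: cvgD.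
Qed.

Lemma difference_quotientE (R : realType) (f : R -> R) (t : R) :
    (fun h : R => h^-1 *: ((f \o shift t) (h *: 1) - f t)) =
    (fun h : R => h^-1 *: (f (h + t) - f t)).
Proof. by apply/funext => h /=; rewrite [h *: 1]mulr1. Qed.

Section chain_rule.
Context (R : realType) (m : nat).
Implicit Types (u : 'rV[R]_m -> R) (x y z v : 'rV[R]_m).

Lemma is_derive_line u z v (s : R) : derivable u (z + s *: v) v ->
  is_derive s 1 (fun t : R => u (z + t *: v)) ('D_v u (z + s *: v)).
Proof.
move=> du.
have E : (fun h : R => h^-1 *: (((fun t : R => u (z + t *: v)) \o shift s)
      (h *: 1) - u (z + s *: v))) =
    (fun h : R => h^-1 *: ((u \o shift (z + s *: v)) (h *: v) - u (z + s *: v))).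
  apply/funext => h /=; congr (_ *: (u _ - _)).
  by rewrite [h *: 1]mulr1 scalerDl addrCA addrC.
by apply: DeriveDef; rewrite /derivable /derive E.
Qed.

Lemma coordinate_MVT u z (k : 'I_m) (d : R) : Ck 1 u ->
  exists2 c, `|c| <= `|d| &
    u (z + d *: delta_mx 0 k) - u z = partial k u (z + c *: delta_mx 0 k) * d.
Proof.
move=> [_ C1u]; have [du _] := C1u k.
pose g (t : R) := u (z + t *: delta_mx 0 k).
have dg (s : R) : is_derive s 1 g (partial k u (z + s *: delta_mx 0 k)).
  exact: is_derive_line.
have cg : continuous g.
  move=> s; apply: differentiable_continuous; apply/derivable1_diffP.
  by have [] := dg s.
have g0 : u z = g 0 by rewrite /g scale0r addr0.
have [d0|d0] := leP 0 d.
  have [c /itvP c0d] := MVT_segment d0 (fun t _ => dg t)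
    (continuous_subspaceT cg).
  rewrite subr0 g0 => E; exists c => //.
  by rewrite !ger0_norm// ?c0d.
have [c /itvP c0d] := MVT_segment (ltW d0) (fun t _ => dg t)
  (continuous_subspaceT cg).
rewrite sub0r mulrN g0 => /eqP; rewrite -eqr_oppLR opprB => /eqP E.
exists c => //.
by rewrite !ler0_norm ?lerN2 ?c0d// ltW.
Qed.

(** The path from [x] to [y] replaces one coordinate at a time: [z n] has the first [n] coordinates
    of [y] and the others of [x]. Each leg is a one-variable mean value problem, and its
    intermediate point differs from [x] in no coordinate by more than [y] can. *)
Lemma row_MVT u x y : Ck 1 u ->
  exists2 xi : 'I_m -> 'rV[R]_m, (forall k, `|xi k - x| <= `|y - x|) &
    u y - u x = \sum_k partial k u (xi k) * (y 0 k - x 0 k).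
Proof.
move=> C1u.
pose z (n : nat) : 'rV[R]_m := \row_i (if (i < n)%N then y 0 i else x 0 i).
have zS (k : 'I_m) : z k.+1 = z k + (y 0 k - x 0 k) *: delta_mx 0 k.
  apply/rowP => i; rewrite !mxE eqxx ltnS leq_eqVlt /=.
  have [->|ik] := eqVneq i k; first by rewrite eqxx ltnn mulr1 addrC subrK.
  by rewrite (negPf (ik : val i != val k)) mulr0 addr0.
have /choice[c Hc] (k : 'I_m) : exists c, `|c| <= `|y 0 k - x 0 k| /\
    u (z k.+1) - u (z k) =
    partial k u (z k + c *: delta_mx 0 k) * (y 0 k - x 0 k).
  rewrite zS.
  by have [c ? ?] := coordinate_MVT (z k) k (y 0 k - x 0 k) C1u; exists c.
exists (fun k : 'I_m => z k + c k *: delta_mx 0 k) => [k|].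
  apply: row_norm_le => // i; rewrite !mxE eqxx/=.
  have [->|ik] := eqVneq i k.
    rewrite ltnn mulr1 addrAC subrr add0r.
    by apply: le_trans (Hc k).1 _; rewrite (le_trans _ (coord_le_norm _ k))// !mxE.
  rewrite mulr0 addr0; case: ifP => _.
    by rewrite (le_trans _ (coord_le_norm _ i))// !mxE.
  by rewrite subrr normr0.
transitivity (\sum_(k < m) (u (z k.+1) - u (z k))); last first.
  by apply: eq_bigr => k _; rewrite (Hc k).2.
rewrite -(big_mkord xpredT (fun k : nat => u (z k.+1) - u (z k))).
rewrite (telescope_sumr (u \o z))//=.
by congr (u _ - u _); apply/rowP => i; rewrite !mxE ?ltn_ord.
Qed.

(** [row_MVT] turns the difference quotient into quotients of the coordinates of [g] times partials
    at points squeezed towards [g t], where the partials are continuous. *)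
Lemma is_derive_comp_row u (g : R -> 'rV[R]_m) (t : R) (dg : 'I_m -> R) :
  Ck 1 u -> (forall i, is_derive t 1 (fun s : R => g s 0 i) (dg i)) ->
  is_derive t 1 (fun s : R => u (g s)) (\sum_i dg i * partial i u (g t)).
Proof.
move=> C1u Hg.
have cg : g s @[s --> t] --> g t.
  apply: cvg_row => i; apply: differentiable_continuous; apply/derivable1_diffP.
  by have [] := Hg i.
have /choice[xi Hxi] : forall h : R, exists xi : 'I_m -> 'rV[R]_m,
    (forall k, `|xi k - g t| <= `|g (h + t) - g t|) /\
    u (g (h + t)) - u (g t) =
    \sum_k partial k u (xi k) * (g (h + t) 0 k - g t 0 k).
  by move=> h; have [xi ? ?] := row_MVT (g t) (g (h + t)) C1u; exists xi.
have cgh : g (h + t) @[h --> 0^'] --> g t.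
  have ht : h + t @[h --> 0^'] --> t.
    rewrite -[X in _ --> X](add0r t); apply: cvgD; last exact: cvg_cst.
    exact: nbhs_dnbhs.
  exact: (cvg_comp _ _ ht cg).
have cxi k : xi h k @[h --> 0^'] --> g t.
  apply/cvgrPdist_le => e e0.
  move/cvgrPdist_le : cgh => /(_ e e0); apply: filterS => h.
  by rewrite distrC => he; rewrite distrC; exact: le_trans ((Hxi h).1 k) he.
have cvgQ : h^-1 *: (u (g (h + t)) - u (g t)) @[h --> 0^'] -->
    \sum_i dg i * partial i u (g t).
  rewrite (_ : (fun h : R => _) = (fun h : R => \sum_k
      (h^-1 *: (g (h + t) 0 k - g t 0 k)) * partial k u (xi h k))); last first.
    apply/funext => h; rewrite (Hxi h).2 scaler_sumr; apply: eq_bigr => k _.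
    by rewrite /GRing.scale/= mulrCA mulrC.
  apply: cvg_fct_sum => k; apply: cvgM.
    have [dk <-] := Hg k; rewrite -(difference_quotientE (fun s => g s 0 k)); exact: dk.
  by have [_ [cp _]] := C1u.2 k; exact: (cvg_comp _ _ (cxi k) (cp _)).
apply: DeriveDef; rewrite /derivable /derive (difference_quotientE (fun s => u (g s))).
  exact: cvgP cvgQ.
exact/cvg_lim.
Qed.

End chain_rule.

(** * Rotation invariance of the Lebesgue measure *)

(** Translation keeps the length of half-open intervals, and these lengths determine the Lebesgue
    measure. *)
Lemma lebesgue_measure_translate (R : realType) (a : R)
    (A : set (measurableTypeR R)) : measurable A ->
  lebesgue_measure ((fun x : R => x + a) @^-1` A) = lebesgue_measure A.
Proof.
move=> mA.
have mf : measurable_fun setT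
    ((fun x : R => x + a) : measurableTypeR R -> measurableTypeR R).
  exact: measurable_funD.
pose p := measure_function_pushforward__canonical__measure_function_Measure
  (@lebesgue_measure R) mf.
rewrite [RHS](@lebesgue_measure_unique R p)// => _ [[b c] _ <-] /=.
rewrite /pushforward (_ : _ @^-1` _ = `]b - a, c - a]%classic); last first.
  by apply/seteqP; split => x /=; rewrite !in_itv/= ltrBlDr lerBrDr.
rewrite !lebesgue_measure_itv/= !lte_fin ltrD2r; case: ifP => // _.
by rewrite -!EFinD; congr EFin; ring.
Qed.

Definition preserves d (T : measurableType d) (R : realType)
    (mu : set T -> \bar R) (f : T -> T) :=
  measurable_fun setT f /\ forall A, measurable A -> mu (f @^-1` A) = mu A.

Lemma preserves_comp d (T : measurableType d) (R : realType)
    (mu : set T -> \bar R) (f g : T -> T) :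
  preserves mu f -> preserves mu g -> preserves mu (f \o g).
Proof.
move=> [mf pf] [mg pg]; split; first exact: measurableT_comp.
move=> A mA; rewrite comp_preimage pg ?pf//.
by rewrite -[X in measurable X]setTI; exact: mf.
Qed.

Section product_preserves.
Context d (T : measurableType d) (R : realType).
Context (mu : {sigma_finite_measure set T -> \bar R}).
Local Notation TR := (measurableTypeR R).
Let lam := @lebesgue_measure R.

(** On a slice with fixed second component the map is a translation, so the product measure is first
    rewritten, by uniqueness, as an integral over those slices. *)
Lemma preserves_product_shift (g : T -> R) : measurable_fun setT g ->
  preserves (product_measure1 lam mu) (fun p : TR * T => (p.1 + g p.2, p.2)).
Proof.
move=> mg.
have mf : measurable_fun setT (fun p : TR * T => (p.1 + g p.2 : TR, p.2)).
  apply: measurable_fun_pair => //.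
  by apply: measurable_funD => //; exact: measurableT_comp.
split=> // A mA.
have mfA : measurable ((fun p : TR * T => (p.1 + g p.2 : TR, p.2)) @^-1` A).
  by rewrite -[X in measurable X]setTI; exact: mf.
have E B : measurable B ->
    product_measure1 lam mu B = product_measure2 lam mu B.
  move=> mB; apply: product_measure_unique => //= ? ? ? ?.
  by rewrite product_measure2E.
rewrite !E// /product_measure2; apply: eq_integral => y _ /=.
rewrite -[RHS](lebesgue_measure_translate (g y)); last first.
  exact: measurable_ysection.
congr (lam _); apply/seteqP; split => x /=;
  by rewrite /ysection/= !inE.
Qed.

Lemma preserves_product_fiber (psi : TR -> T -> T) :
  measurable_fun setT (fun p : TR * T => psi p.1 p.2) ->
  (forall x, preserves mu (psi x)) ->
  preserves (product_measure1 lam mu) (fun p : TR * T => (p.1, psi p.1 p.2)).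
Proof.
move=> mpsi ppsi.
split=> [|A mA]; first exact: measurable_fun_pair.
rewrite /product_measure1; apply: eq_integral => x _ /=.
rewrite -[RHS](ppsi x).2; last exact: measurable_xsection.
congr (mu _); apply/seteqP; split => y /=;
  by rewrite /xsection/= !inE.
Qed.

End product_preserves.

Definition shear (R : realType) n (i : 'I_n)
    (f : n.-tuple (measurableTypeR R) -> R) (t : n.-tuple (measurableTypeR R)) :
    n.-tuple (measurableTypeR R) :=
  [tuple if k == i then tnth t k + f t else tnth t k | k < n].

Lemma measurable_shear (R : realType) n (i : 'I_n)
    (f : n.-tuple (measurableTypeR R) -> R) :
  measurable_fun setT f -> measurable_fun setT (shear i f).
Proof.
move=> mf; apply/measurable_fun_tnthP => k.
rewrite (_ : _ \o _ =
    fun t => if k == i then tnth t k + f t else tnth t k); last first.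
  by apply/funext => t /=; rewrite tnth_mktuple.
case: (k == i); last exact: measurable_tnth.
by apply: measurable_funD => //; exact: measurable_tnth.
Qed.

(** Induction along the iterated product: for [i = 0] the head is shifted by a function of the tail;
    otherwise the tail undergoes a shear one dimension lower, with the head as parameter.
    Independence of [f] from coordinate [i] is what makes the map a translation on each line in
    direction [i]. *)
Lemma preserves_shear (R : realType) n (i : 'I_n)
    (f : n.-tuple (measurableTypeR R) -> R) :
  measurable_fun setT f ->
  (forall s t, (forall k, k != i -> tnth s k = tnth t k) -> f s = f t) ->
  preserves (@lebesgue_tuple R n) (shear i f).
Proof.
elim: n => [|n IH] in i f *; first by case: i.
move=> mf hf; split; first exact: measurable_shear.
move=> A mA.
pose cons (p : measurableTypeR R * n.-tuple (measurableTypeR R)) :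
  n.+1.-tuple (measurableTypeR R) := [tuple of p.1 :: p.2].
have mcons : measurable_fun setT cons by exact: measurable_cons.
have mcA : measurable (cons @^-1` A).
  by rewrite -[X in measurable X]setTI; exact: mcons.
rewrite /= /pushforward.
have tnth_cons0 p : tnth (cons p) ord0 = p.1 by [].
have tnth_consS p k : tnth (cons p) (lift ord0 k) = tnth p.2 k.
  by rewrite tnthS; congr tnth; apply: val_inj.
have [i0|[j ij]] : i = ord0 \/ exists j, i = lift ord0 j.
  by case: (unliftP ord0 i) => [j ->|->]; [right; exists j|left].
- subst i.
  (* The value 0 is arbitrary: [f] does not depend on the coordinate that it fills. *)
  have mg : measurable_fun setT (fun t => f (cons (0, t))).
    apply: (measurableT_comp mf).
    exact: (@measurable_cons _ _ (n.-tuple (measurableTypeR R))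
      (measurableTypeR R) (fun=> 0) n id).
  rewrite -[RHS](preserves_product_shift _ mg).2//; congr (product_measure1 _ _ _).
  apply/funext => -[x t]; rewrite /preimage/=; congr A.
  apply: eq_from_tnth => k; rewrite tnth_mktuple.
  have -> : f (cons (x, t)) = f (cons (0, t)).
    apply: hf => k'; case: (unliftP ord0 k') => [l ->|->]; last by rewrite eqxx.
    by move=> _; rewrite !tnth_consS.
  case: (unliftP ord0 k) => [l ->|->//].
  rewrite eq_sym (negPf (neq_lift _ _)).
  by rewrite (tnth_consS (x, t)) (tnth_consS (x + f (cons (0, t)), t)).
- subst i.
  pose psi (x : measurableTypeR R) := shear j (fun t => f (cons (x, t))).
  have ppsi x : preserves (@lebesgue_tuple R n) (psi x).
    apply: IH.
      apply: (measurableT_comp mf).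
      exact: (@measurable_cons _ _ (n.-tuple (measurableTypeR R))
        (measurableTypeR R) (fun=> x) n id).
    move=> s t st; apply: hf => k.
    case: (unliftP ord0 k) => [l ->|->//].
    by rewrite !tnth_consS => lj; apply: st; apply: contra_neq lj => ->.
  have mpsi : measurable_fun setT (fun p : measurableTypeR R *
      n.-tuple (measurableTypeR R) => psi p.1 p.2).
    apply/measurable_fun_tnthP => k.
    have mk : measurable_fun setT (fun p : measurableTypeR R *
      n.-tuple (measurableTypeR R) => tnth p.2 k).
      exact: (measurableT_comp (@measurable_tnth _ _ n k) measurable_snd).
    rewrite (_ : _ \o _ =
        fun p => if k == j then tnth p.2 k + f (cons p) else tnth p.2 k).
      by case: (k == j) => //; apply: measurable_funD => //;
        exact: (measurableT_comp mf mcons).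
    by apply/funext => -[x t] /=; rewrite tnth_mktuple.
  rewrite -[RHS](preserves_product_fiber mpsi ppsi).2//.
  congr (product_measure1 _ _ _).
  apply/funext => -[x t]; rewrite /preimage/=; congr A.
  apply: eq_from_tnth => k; rewrite tnth_mktuple.
  case: (unliftP ord0 k) => [l ->|->]; last by rewrite (negPf (neq_lift _ _)).
  rewrite (tnth_consS (x, t)) (tnth_consS (x, psi x t)) tnth_mktuple.
  by rewrite (inj_eq (@lift_inj _ ord0)).
Qed.

(** * Measurability of the norm, the sphere and the direction map *)

Section sphere_measurability.
Context (R : realType) (m : nat).
Local Notation T := (measurableTypeR R).

Lemma measurable_enorm_row :
  measurable_fun setT (fun t : m.-tuple T => enorm (row_of_tuple t)).
Proof.
rewrite /enorm; apply: (@measurableT_comp _ _ _ _ _ _ (@Num.sqrt R)).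
  exact: (continuous_measurable_fun (@sqrt_continuous R)).
apply: measurable_sum => i.
rewrite (_ : (fun t => _) = (fun t => tnth t i ^+ 2)); last first.
  by apply/funext => t; rewrite mxE.
by apply: measurable_funX; exact: measurable_tnth.
Qed.

Lemma measurable_punctured_unit_ball : measurable (@punctured_unit_ball R m).
Proof.
rewrite (_ : @punctured_unit_ball R m =
  (fun t : m.-tuple T => enorm (row_of_tuple t)) @^-1` `]0, 1]).
  by rewrite -[X in measurable X]setTI; exact: measurable_enorm_row.
by apply/seteqP; split=> t; rewrite /= in_itv.
Qed.

Lemma measurable_unit_sphere : measurable (@unit_sphere R m).
Proof.
rewrite -[X in measurable X]setTI.
by apply: (@measurable_enorm_row measurableT [set 1]); exact: measurable_set1.
Qed.

Lemma measurable_direction : measurable_fun setT (@direction R m).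
Proof.
apply/measurable_fun_tnthP => i.
rewrite (_ : _ \o _ = fun t => tnth t i * enorm (row_of_tuple t) `^ (-1)).
  apply: measurable_funM; first exact: measurable_tnth.
  apply: (@measurableT_comp _ _ _ _ _ _ (fun x : R => x `^ (-1))) => //.
  exact: measurable_enorm_row.
by apply/funext => t /=; rewrite tnth_mktuple powR_inv1// sqrtr_ge0.
Qed.

End sphere_measurability.

Section enorm.
Context (R : realType) (m : nat).
Implicit Types x : 'rV[R]_m.

Lemma sqr_enorm x : enorm x ^+ 2 = \sum_i x 0 i ^+ 2.
Proof. by rewrite sqr_sqrtr// sumr_ge0// => i _; rewrite sqr_ge0. Qed.

Lemma enorm_ge0 x : 0 <= enorm x. Proof. exact: sqrtr_ge0. Qed.

Lemma enormZ (a : R) x : enorm (a *: x) = `|a| * enorm x.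
Proof.
apply/eqP; rewrite -(@eqrXn2 _ 2) ?mulr_ge0 ?enorm_ge0//.
rewrite exprMn real_normK ?num_real// !sqr_enorm mulr_sumr.
by apply/eqP/eq_bigr => i _; rewrite mxE exprMn.
Qed.

Lemma coord_le_enorm x i : `|x 0 i| <= enorm x.
Proof.
rewrite -(@ler_pXn2r _ 2) ?nnegrE ?enorm_ge0// real_normK ?num_real//.
by rewrite sqr_enorm (bigD1 i)//= lerDl sumr_ge0// => k _; rewrite sqr_ge0.
Qed.

End enorm.

(** * Rotations in a coordinate plane *)

Section rotation.
Context (R : realType) (m : nat).
Local Notation T := (measurableTypeR R).
Context (i j : 'I_m).

(** A rotation when [c^2 + s^2 = 1]; [c] and [s] stay free so that its properties are polynomial
    identities, and an angle enters only on differentiation. *)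
Definition plane_rot (c s : R) (x : 'rV[R]_m) : 'rV[R]_m :=
  \row_k (if k == i then c * x 0 i - s * x 0 j
          else if k == j then s * x 0 i + c * x 0 j else x 0 k).

Definition plane_rot_tuple (c s : R) (t : m.-tuple T) : m.-tuple T :=
  [tuple if k == i then c * tnth t i - s * tnth t j
         else if k == j then s * tnth t i + c * tnth t j else tnth t k | k < m].

Lemma row_of_rot_tuple c s t :
  row_of_tuple (plane_rot_tuple c s t) = plane_rot c s (row_of_tuple t).
Proof. by apply/rowP => k; rewrite !mxE tnth_mktuple. Qed.

Lemma plane_rotZ c s (a : R) x : plane_rot c s (a *: x) = a *: plane_rot c s x.
Proof.
by apply/rowP => k; rewrite !mxE; do 2?[case: ifP => _]; rewrite ?mxE//; ring.
Qed.

Context (ij : i != j).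

Lemma enorm_plane_rot c s x : c ^+ 2 + s ^+ 2 = 1 -> enorm (plane_rot c s x) = enorm x.
Proof.
move=> cs; congr Num.sqrt.
have ji : j != i by rewrite eq_sym.
rewrite (bigD1 i)//= [RHS](bigD1 i)//= (bigD1 j)//= [X in _ = _ + X](bigD1 j)//=.
rewrite !addrA !mxE eqxx (negPf ji) eqxx; congr (_ + _); last first.
  by apply: eq_bigr => k /andP[/negPf ki /negPf kj]; rewrite mxE ki kj.
rewrite -[RHS]mul1r -cs; ring.
Qed.

Lemma direction_rot_tuple c s t : c ^+ 2 + s ^+ 2 = 1 ->
  direction (plane_rot_tuple c s t) = plane_rot_tuple c s (direction t).
Proof.
move=> cs; apply: eq_from_tnth => k.
rewrite !tnth_mktuple row_of_rot_tuple enorm_plane_rot//.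
by do 2?[case: ifP => _]; rewrite // mulrDl ?mulNr -!mulrA.
Qed.

(* A rotation by less than a half turn is a product of three shears. *)
Lemma preserves_rot_tuple c s : c ^+ 2 + s ^+ 2 = 1 -> 1 + c != 0 ->
  preserves (@lebesgue_tuple R m) (plane_rot_tuple c s).
Proof.
(* For [c = cos t] and [s = sin t], [a] is [tan (t/2)]; [1 + c != 0] excludes the half turn. *)
move=> cs c1; pose a := s / (1 + c).
have ji : j != i by rewrite eq_sym.
have psh (k l : 'I_m) (b : R) : k != l ->
    preserves (@lebesgue_tuple R m) (shear k (fun t => b * tnth t l)).
  move=> kl; apply: preserves_shear.
    by apply: measurable_funM => //; exact: measurable_tnth.
  by move=> t t' tt'; rewrite tt'// eq_sym.
rewrite (_ : plane_rot_tuple c s = shear i (fun t => - a * tnth t j) \o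
    (shear j (fun t => s * tnth t i) \o shear i (fun t => - a * tnth t j))).
  by apply: preserves_comp; [|apply: preserves_comp]; exact: psh.
have sa : s * a = 1 - c.
  have -> : 1 - c = (c ^+ 2 + s ^+ 2 - c ^+ 2) / (1 + c) by rewrite cs; field.
  by rewrite /a; field.
have ac : a * (1 + c) = s by rewrite /a; field.
apply/funext => t; apply: eq_from_tnth => k; rewrite /= !tnth_mktuple.
rewrite !eqxx ?(negPf ij) ?(negPf ji).
have [->|ki] := eqVneq k i.
  rewrite (negPf ij); move: (tnth t i) (tnth t j) => x y.
  transitivity ((1 - s * a) * x - a * (2 - s * a) * y); last by ring.
  by rewrite sa -{1}ac; ring.
have [->|//] := eqVneq k j; move: (tnth t i) (tnth t j) => x y.
transitivity (s * x + (1 - s * a) * y); last by ring.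
by rewrite sa; ring.
Qed.

End rotation.

(** * Integration over the sphere *)

Lemma bigcapT_measurable_countType d (T : measurableType d) (I : countType)
    (F : I -> set T) :
  (forall i, measurable (F i)) -> measurable (\bigcap_i F i).
Proof.
move=> mF; rewrite -[X in measurable X]setCK setC_bigcap.
apply/measurableC/countable_bigcupT_measurable => // i.
exact: measurableC.
Qed.

Section row_measurability.
Context (R : realType) (m : nat).
Local Notation T := (measurableTypeR R).

(* [f] is the limit of its values at the grid points with mesh [1/(n+1)]; these
   approximations are measurable because they factor through a countable set. *)
Lemma measurable_continuous_row (f : 'rV[R]_m -> R) : continuous f ->
  measurable_fun setT (fun t : m.-tuple T => f (row_of_tuple t)).
Proof.
move=> cf.
pose fl (n : nat) (t : m.-tuple T) : m.-tuple int :=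
  [tuple Num.floor (n.+1%:R * tnth t i) | i < m].
pose grid (n : nat) (k : m.-tuple int) : 'rV[R]_m :=
  \row_i ((tnth k i)%:~R / n.+1%:R).
apply: (@measurable_fun_cvg _ _ _ _ (fun n t => f (grid n (fl n t)))).
- move=> n _ Y mY; rewrite setTI.
  (* The approximation is constant on each grid cell; the preimage of [Y] is the union of the cells
     whose value lies in [Y]. *)
  pose F (k : m.-tuple int) := if asbool (Y (f (grid n k)))
    then \bigcap_(i in [set: 'I_m]) [set t : m.-tuple T |
      (tnth k i)%:~R <= n.+1%:R * tnth t i < (tnth k i + 1)%:~R]
    else set0.
  rewrite (_ : _ @^-1` _ = \bigcup_k F k); last first.
    apply/seteqP; split => [t /= Yt|t [k _]]; rewrite /F.
      exists (fl n t) => //; rewrite asboolT// => i _ /=.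
      by rewrite tnth_mktuple floor_itv.
    case: asboolP => //= Yk H; rewrite (_ : fl n t = k)//.
    apply: eq_from_tnth => i; rewrite tnth_mktuple.
    exact/floor_def/(H i).
  apply: countable_bigcupT_measurable => // k; rewrite /F.
  case: asboolP => // _.
  apply: bigcapT_measurable_countType => i.
  rewrite (_ : [set t | _] = (fun t : m.-tuple T => n.+1%:R * tnth t i) @^-1`
    `[(tnth k i)%:~R, (tnth k i + 1)%:~R[%classic).
    rewrite -[X in measurable X]setTI.
    by apply: measurable_funM => //; exact: measurable_tnth.
  by apply/seteqP; split => t /=; rewrite in_itv.
- move=> t _; apply: (@cvg_comp _ _ _ (fun n => grid n (fl n t)) f _
    (nbhs (row_of_tuple t))); last exact: cf.
  apply: cvg_row => i; apply/cvgrPdist_le => e e0.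
  near=> n; rewrite !mxE tnth_mktuple.
  have := floor_itv (n.+1%:R * tnth t i); set q := Num.floor _.
  rewrite intrD => /andP[q1 q2].
  have n0 : 0 < n.+1%:R :> R by [].
  have -> : tnth t i - q%:~R / n.+1%:R = (n.+1%:R * tnth t i - q%:~R) / n.+1%:R.
    by field; rewrite gt_eqF.
  rewrite ger0_norm; last by rewrite divr_ge0// subr_ge0.
  rewrite ler_pdivrMr//; apply: (@le_trans _ _ 1).
    by rewrite lerBlDl ltW.
  rewrite -ler_pdivrMl// mulr1; apply: (@le_trans _ _ n%:R).
    by near: n; exact: nbhs_infty_ger.
  by rewrite ler_nat.
Unshelve. all: by end_near. Qed.

Lemma measurable_box n (a b : 'I_n -> R) :
  measurable [set t : n.-tuple T | forall i, tnth t i \in `[a i, b i]].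
Proof.
rewrite (_ : [set t | _] = \bigcap_i
    ((fun t : n.-tuple T => tnth t i) @^-1` `[a i, b i]%classic)).
  apply: bigcapT_measurable_countType => i.
  by rewrite -[X in measurable X]setTI; exact: measurable_tnth.
by apply/seteqP; split => [t tB i _|t tB i]; [exact: tB|exact: (tB i I)].
Qed.

(** The upper bound serves to make the sphere measure finite, the lower bound to find positive mass
    near a given direction in [sint_eq0]. *)
Lemma lebesgue_tuple_box n (a b : 'I_n -> R) : (forall i, a i < b i) ->
  (0 < @lebesgue_tuple R n
    [set t | forall i, tnth t i \in `[a i, b i]] < +oo)%E.
Proof.
elim: n => [|n IH] in a b * => ab.
  rewrite /= diracE mem_set ?lte01 ?ltry//.
  by move=> /= [].
have mI (i : 'I_n) : a (lift ord0 i) < b (lift ord0 i) by [].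
have := IH _ _ mI.
set B := [set t | _] => /andP[B0 Boo].
rewrite /= /pushforward (_ : _ @^-1` _ = `[a ord0, b ord0]%classic `*` B); last first.
  apply/seteqP; split => -[x t] /=.
    move=> H; split; first by have := H ord0.
    by move=> i; have := H (lift ord0 i); rewrite tnthS;
      congr (tnth _ _ \in _); apply: val_inj.
  move=> [xab tB] i; case: (unliftP ord0 i) => [k ->|->//].
  by have := tB k; rewrite tnthS; congr (tnth _ _ \in _); apply: val_inj.
have mB : measurable B by exact: measurable_box.
rewrite product_measure1E//= lebesgue_measure_itv/= lte_fin ab -EFinD.
rewrite mule_gt0 ?lte_fin ?subr_gt0//=.
by rewrite lte_mul_pinfty// lee_fin subr_ge0 ltW.
Qed.

End row_measurability.

Section sphere_integral.
Context (R : realType) (m : nat).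
Local Notation T := (measurableTypeR R).
Local Notation mu := (@sphere_measure R m).
Local Notation S := (@unit_sphere R m).
Implicit Types f g : 'rV[R]_m -> R.

Definition sint f : R := \int[mu]_(t in S) f (row_of_tuple t).

(** The cone over the sphere lies in the unit ball, hence in the box [[-1, 1]^m]. *)
Lemma sphere_measure_lty : (mu S < +oo)%E.
Proof.
have l1 : (-1 : R) < 1 by lra.
have := @lebesgue_tuple_box R m (fun=> -1) (fun=> 1) (fun=> l1).
set B := [set t | _] => /andP[_ Boo].
rewrite /sphere_measure lte_mul_pinfty ?lee_fin//.
apply: le_lt_trans Boo; apply: le_measure; rewrite ?inE.
- apply: measurableI; last exact: measurable_punctured_unit_ball.
  rewrite -[X in measurable X]setTI; apply: measurable_direction => //.
  exact: measurable_unit_sphere.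
- exact: measurable_box.
- move=> t [_ /= /andP[_ t1]] i; rewrite in_itv/= -ler_norml.
  by apply: le_trans t1; have := coord_le_enorm (row_of_tuple t) i; rewrite mxE.
Qed.

Lemma integrable_sphere f : continuous f ->
  mu.-integrable S (EFin \o (f \o @row_of_tuple R m)).
Proof.
move=> cf; apply: measurable_bounded_integrable.
- exact: measurable_unit_sphere.
- exact: sphere_measure_lty.
- exact: (measurable_funTS (measurable_continuous_row cf)).
- have cf2 : continuous (fun p : R * 'rV[R]_m => f p.2).
    by move=> p; apply: (@cvg_comp _ _ _ snd f); [exact: cvg_snd|exact: cf].
  have [M HM] := continuous_cube_bounded 0 0 1 cf2.
  exists M; split; first exact: num_real.
  move=> y My t /= tS; apply: le_trans (ltW My).
  apply: (HM 0); first by rewrite lexx.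
  by move=> i; rewrite -tS coord_le_enorm.
Qed.

Lemma sintD f g : continuous f -> continuous g ->
  sint (fun x => f x + g x) = sint f + sint g.
Proof.
by move=> cf cg; rewrite /sint RintegralD//;
  [exact: measurable_unit_sphere|exact: integrable_sphere|exact: integrable_sphere].
Qed.

Lemma sintZ f (a : R) : continuous f -> sint (fun x => a * f x) = a * sint f.
Proof.
by move=> cf; rewrite /sint RintegralZl//;
  [exact: measurable_unit_sphere|exact: integrable_sphere].
Qed.

Lemma sint_ge0 f : (forall x, 0 <= f x) -> 0 <= sint f.
Proof. by move=> f0; apply: Rintegral_ge0. Qed.

Lemma eq_sint f g : (forall x, enorm x = 1 -> f x = g x) -> sint f = sint g.
Proof.
by move=> fg; apply: eq_Rintegral => t; rewrite inE => tS; exact: fg.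
Qed.

(** Rotations keep the norm and commute with [direction], so the cone over a preimage is the
    preimage of the cone; invariance of the Lebesgue measure then passes to the sphere measure. *)
Lemma sint_rot (i j : 'I_m) (c s : R) f : i != j ->
  c ^+ 2 + s ^+ 2 = 1 -> 1 + c != 0 -> continuous f ->
  continuous (f \o plane_rot i j c s) -> sint (f \o plane_rot i j c s) = sint f.
Proof.
move=> ij cs c1 cf cfr.
have [mr pr] := preserves_rot_tuple ij cs c1.
have rS : plane_rot_tuple i j c s @^-1` S = S.
  by apply/seteqP; split => t;
    rewrite /preimage/unit_sphere/= row_of_rot_tuple enorm_plane_rot.
have fE : f \o plane_rot i j c s \o @row_of_tuple R m =
    f \o @row_of_tuple R m \o plane_rot_tuple i j c s.
  by apply/funext => t /=; rewrite row_of_rot_tuple.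
rewrite /sint /Rintegral; congr fine.
pose p := measure_function_pushforward__canonical__measure_function_Measure mu mr.
have mf : measurable_fun setT (fun t : m.-tuple T => (f (row_of_tuple t))%:E).
  by apply/measurable_EFinP; exact: measurable_continuous_row.
transitivity (\int[p]_(t in S) (f (row_of_tuple t))%:E)%E.
  rewrite integral_pushforward//.
  - by rewrite rS; apply: eq_integral => t _ /=; rewrite row_of_rot_tuple.
  - rewrite rS (_ : _ \o _ =
      EFin \o (f \o plane_rot i j c s \o @row_of_tuple R m)); last by rewrite fE.
    exact: integrable_sphere.
  - exact: measurable_unit_sphere.
apply: eq_measure_integral => A mA _.
rewrite /= /pushforward /sphere_measure; congr (_ * _)%E.
have mD : measurable (@direction R m @^-1` A `&` @punctured_unit_ball R m).
  apply: measurableI; last exact: measurable_punctured_unit_ball.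
  by rewrite -[X in measurable X]setTI; exact: measurable_direction.
rewrite -[RHS]pr//; congr (lebesgue_tuple _).
apply/seteqP; split => t; rewrite /preimage/punctured_unit_ball/=;
  by rewrite direction_rot_tuple// row_of_rot_tuple enorm_plane_rot.
Qed.

Lemma continuous_enorm : continuous (@enorm R m).
Proof.
move=> x; rewrite /enorm.
apply: (@cvg_comp _ _ _ (fun x : 'rV[R]_m => \sum_i x 0 i ^+ 2) Num.sqrt _
  (nbhs (\sum_i x 0 i ^+ 2))); last exact: sqrt_continuous.
by apply: (@cvg_fct_sum _ _ (nbhs x)) => i; apply: cvgM; exact: coord_continuous.
Qed.

Lemma row_of_direction (t : m.-tuple T) :
  row_of_tuple (direction t) = (enorm (row_of_tuple t))^-1 *: row_of_tuple t.
Proof. by apply/rowP => i; rewrite !mxE tnth_mktuple mulrC. Qed.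

(** A positive value at [x] would persist, by continuity, in the directions of all points of a small
    box in the punctured unit ball. The cone over the null set where [f] may be nonzero would then
    contain a box of positive volume. *)
Lemma sint_eq0 f : (0 < m)%N -> continuous f -> (forall x, 0 <= f x) -> sint f = 0 ->
  forall x, enorm x = 1 -> f x = 0.
Proof.
move=> m0 cf f0 sf0 x x1.
have : ae_eq mu S (EFin \o (f \o @row_of_tuple R m)) (cst 0%E).
  apply/ae_eq_integral_abs.
  - exact: measurable_unit_sphere.
  - exact: measurable_int (integrable_sphere cf).
  transitivity (\int[mu]_(t in S) (f (row_of_tuple t))%:E)%E.
    by apply: eq_integral => t _ /=; rewrite ger0_norm.
  have := integrable_fin_num (@measurable_unit_sphere R m) (integrable_sphere cf).
  by move=> /fineK <-; congr EFin.
move=> [N [mN N0 SN]].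
apply: contrapT => fx0.
(* Halving moves [x] strictly inside the punctured ball, so that a whole neighbourhood stays in
   it. *)
pose y0 : 'rV[R]_m := 2^-1 *: x.
have y0E : enorm y0 = 2^-1 by rewrite enormZ x1 mulr1 ger0_norm.
have near_pos : \forall y \near y0, 0 < enorm y.
  by apply: (cvgr_gt _ (@continuous_enorm y0)); rewrite y0E.
have near_le1 : \forall y \near y0, enorm y < 1.
  by apply: (cvgr_lt _ (@continuous_enorm y0)); rewrite y0E; lra.
have near_f : \forall y \near y0, 0 < f ((enorm y)^-1 *: y).
  have cy : (enorm y)^-1 *: y @[y --> y0] --> (enorm y0)^-1 *: y0.
    have y0n : enorm y0 != 0 by rewrite y0E.
    exact: (cvgZ (cvgV y0n (@continuous_enorm y0)) cvg_id).
  apply: (cvgr_gt _ (cvg_comp _ _ cy (cf _))).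
  rewrite y0E /y0 scalerA invrK divff// scale1r lt_neqAle f0 andbT eq_sym.
  exact/eqP.
have : \forall y \near y0, [/\ 0 < enorm y, enorm y < 1 & 0 < f ((enorm y)^-1 *: y)].
  by near=> y; split; near: y.
move=> /nbhs_ballP[e /= e0 He].
have e2 : 0 < e / 2 by rewrite divr_gt0.
have := @lebesgue_tuple_box R m (fun i => y0 0 i - e / 2) (fun i => y0 0 i + e / 2).
set B := [set t | _] => /(_ _)/andP[|B0 _]; first by move=> i; lra.
suff : (0 < mu N)%E by rewrite N0 ltxx.
rewrite /sphere_measure mule_gt0 ?lte_fin ?ltr0n//.
apply: lt_le_trans B0 _; apply: le_measure; rewrite ?inE.
- exact: measurable_box.
- apply: measurableI; last exact: measurable_punctured_unit_ball.
  by rewrite -[X in measurable X]setTI; exact: measurable_direction.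
move=> t tB.
have [] : [/\ 0 < enorm (row_of_tuple t), enorm (row_of_tuple t) < 1 &
    0 < f ((enorm (row_of_tuple t))^-1 *: row_of_tuple t)].
  apply: He; rewrite -ball_normE /=; apply: (@le_lt_trans _ _ (e / 2)); last by lra.
  apply: row_norm_le => [|i]; first exact: ltW.
  have := tB i; rewrite in_itv/= !mxE ler_norml => /andP[? ?]; apply/andP; split; lra.
move=> t0 t1 ft; split; last by rewrite /punctured_unit_ball/= t0 ltW.
apply: SN => /=; rewrite -row_of_direction in ft => /(_ _) H.
have : (f (row_of_tuple (direction t)))%:E = 0%E.
  apply: H; rewrite /unit_sphere/= row_of_direction enormZ ger0_norm;
    last by rewrite invr_ge0 enorm_ge0.
  by rewrite mulVf// gt_eqF.
by move=> [] fE; rewrite fE ltxx in ft.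
Unshelve. all: by end_near. Qed.

(** Joint continuity bounds [dF] for parameters within 1 of [t] and points of the sphere; the
    constant bound is integrable because the sphere has finite measure, and it dominates. *)
Lemma is_derive_sint (F dF : R * 'rV[R]_m -> R) (t : R) :
  continuous F -> continuous dF ->
  (forall (s : R) x, is_derive s 1 (fun s : R => F (s, x)) (dF (s, x))) ->
  is_derive t 1 (fun s : R => sint (fun x => F (s, x))) (sint (fun x => dF (t, x))).
Proof.
move=> cF cdF FdF.
have cpair (s : R) : continuous (fun x : 'rV[R]_m => (s, x)).
  by apply: (@continuous_pair _ _ _ (fun=> s) id) => x;
    [exact: cst_continuous|exact: cvg_id].
have cFs s : continuous (fun x => F (s, x)).
  exact: continuous_comp_fun (cpair s) cF.
have [M HM] := continuous_cube_bounded (t - 1) (t + 1) 1 cdF.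
pose f (s : R) (y : m.-tuple T) := F (s, row_of_tuple y).
have fE s y : partial1of2 f s y = dF (s, row_of_tuple y).
  by rewrite partial1of2E; have [_ <-] := FdF s (row_of_tuple y).
have It : `]t - 1, t + 1[%classic t by rewrite /= in_itv/=; apply/andP; split; lra.
have intf s : `]t - 1, t + 1[%classic s -> mu.-integrable S (EFin \o f s).
  by move=> _; exact: integrable_sphere (cFs s).
have df s y : `]t - 1, t + 1[%classic s -> S y -> derivable (f ^~ y) s 1.
  by move=> _ _; have [] := FdF s (row_of_tuple y).
have intM : mu.-integrable S (EFin \o (fun=> `|M|)).
  by apply: (@integrable_sphere (fun=> `|M|)); exact: cst_continuous.
have fM s y : `]t - 1, t + 1[%classic s -> S y -> `|partial1of2 f s y| <= `|M|.
  rewrite /= in_itv/= => /andP[ts st] yS; rewrite fE.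
  apply: le_trans (ler_norm M); apply: HM; first by rewrite !ltW.
  by move=> i; rewrite -yS coord_le_enorm.
have cvgF := cvg_differentiation_under_integral (@measurable_unit_sphere R m) It intf
  df (fun=> normr_ge0 M) intM fM.
have -> : sint (fun x => dF (t, x)) = \int[mu]_(y in S) partial1of2 f t y.
  by apply: eq_Rintegral => y _; rewrite fE.
apply: DeriveDef; rewrite /derivable /derive
  (difference_quotientE (fun s => sint (fun x => F (s, x)))).
  exact: cvgP cvgF.
exact/cvg_lim.
Qed.

End sphere_integral.

(** * Radial and angular derivatives *)

Section derivatives_on_spheres.
Context (R : realType) (m : nat).
Implicit Types (u f : 'rV[R]_m -> R) (x y : 'rV[R]_m).

Lemma Ck_continuous k u : Ck k u -> continuous u.
Proof. by case: k => [|k] []. Qed.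

Lemma Ck1_partial_continuous u i : Ck 1 u -> continuous (partial i u).
Proof. by move=> [_ /(_ i)[_ []]]. Qed.

Lemma Ck2_Ck1 u : Ck 2 u -> Ck 1 u.
Proof. by move=> [cu Cu]; split => // i; have [du [cp _]] := Cu i. Qed.

Lemma Ck2_partial u i : Ck 2 u -> Ck 1 (partial i u).
Proof. by move=> [_ /(_ i)[]]. Qed.

Lemma continuous_mul (T : topologicalType) (f g : T -> R) :
  continuous f -> continuous g -> continuous (fun t => f t * g t).
Proof. by move=> cf cg t; exact: (cvgM (cf t) (cg t)). Qed.

Lemma continuous_add (T : topologicalType) (f g : T -> R) :
  continuous f -> continuous g -> continuous (fun t => f t + g t).
Proof. by move=> cf cg t; exact: (cvgD (cf t) (cg t)). Qed.

Lemma continuous_sub (T : topologicalType) (f g : T -> R) :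
  continuous f -> continuous g -> continuous (fun t => f t - g t).
Proof. by move=> cf cg t; exact: (cvgB (cf t) (cg t)). Qed.

Lemma continuous_sum (T : topologicalType) (I : Type) (s : seq I)
    (f : I -> T -> R) :
  (forall i, continuous (f i)) -> continuous (fun t => \sum_(i <- s) f i t).
Proof. by move=> cf t; apply: (@cvg_fct_sum _ _ (nbhs t)) => i; exact: cf. Qed.

Lemma continuous_coord2 i : continuous (fun p : R * 'rV[R]_m => p.2 0 i).
Proof.
move=> p; apply: (@cvg_comp _ _ _ snd (fun x : 'rV[R]_m => x 0 i)).
  exact: cvg_snd.
exact: coord_continuous.
Qed.

Lemma continuous_scale_row : continuous (fun p : R * 'rV[R]_m => p.1 *: p.2).
Proof.
apply: continuous_row => i.
rewrite (_ : (fun p => _) = fun p : R * 'rV[R]_m => p.1 * p.2 0 i); last first.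
  by apply/funext => p; rewrite mxE.
apply: continuous_mul => [p|]; [exact: cvg_fst|exact: continuous_coord2].
Qed.

(** At [(r, x)] with [x] a unit vector this is [u_r] at the point [r x]. Radius and direction form
    one argument so that joint continuity can be stated for [is_derive_sint]. *)
Definition radial f (p : R * 'rV[R]_m) : R :=
  \sum_i p.2 0 i * partial i f (p.1 *: p.2).

Definition radial2 f (p : R * 'rV[R]_m) : R :=
  \sum_i p.2 0 i * radial (partial i f) p.

Lemma continuous_radial f : Ck 1 f -> continuous (radial f).
Proof.
move=> C1f; apply: continuous_sum => i; apply: continuous_mul.
  exact: continuous_coord2.
exact: continuous_comp_fun continuous_scale_row (Ck1_partial_continuous C1f).
Qed.

Lemma continuous_radial2 f : Ck 2 f -> continuous (radial2 f).
Proof.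
move=> C2f; apply: continuous_sum => i; apply: continuous_mul.
  exact: continuous_coord2.
exact/continuous_radial/Ck2_partial.
Qed.

Lemma is_derive_mulf (f g : R -> R) (t df dg : R) :
  is_derive t 1 f df -> is_derive t 1 g dg ->
  is_derive t 1 (fun s => f s * g s) (df * g t + f t * dg).
Proof.
move=> Hf Hg; have H := is_deriveM Hf Hg.
by apply: (is_derive_eq H); rewrite /GRing.scale/= addrC [g t * _]mulrC.
Qed.

Lemma is_derive_addf (f g : R -> R) (t df dg : R) :
  is_derive t 1 f df -> is_derive t 1 g dg ->
  is_derive t 1 (fun s => f s + g s) (df + dg).
Proof. by move=> Hf Hg; exact: is_deriveD. Qed.

Lemma is_derive_mulcl (f : R -> R) (c t df : R) :
  is_derive t 1 f df -> is_derive t 1 (fun s => c * f s) (c * df).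
Proof.
move=> Hf; apply: is_derive_eq (is_derive_mulf (is_derive_cst c t 1) Hf) _.
by rewrite mul0r add0r.
Qed.

Lemma is_derive_radial f (r : R) x : Ck 1 f ->
  is_derive r 1 (fun s : R => f (s *: x)) (radial f (r, x)).
Proof.
move=> C1f; apply: (is_derive_comp_row C1f) => i.
rewrite (_ : (fun s => _) = fun s : R => x 0 i * s); last first.
  by apply/funext => s; rewrite mxE mulrC.
by apply: is_derive_eq (is_derive_mulcl _ (is_derive_id r 1)) _; rewrite mulr1.
Qed.

Lemma is_derive_fct_sum n (h : 'I_n -> R -> R) (t : R) (dh : 'I_n -> R) :
  (forall i, is_derive t 1 (h i) (dh i)) ->
  is_derive t 1 (fun s => \sum_i h i s) (\sum_i dh i).
Proof.
move=> Hh; rewrite (_ : (fun s => _) = \sum_i h i); first exact: is_derive_sum.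
by apply/funext => s; rewrite fct_sumE.
Qed.

Lemma is_derive_radial2 f (r : R) x : Ck 2 f ->
  is_derive r 1 (fun s : R => radial f (s, x)) (radial2 f (r, x)).
Proof.
move=> C2f; apply: is_derive_fct_sum => i.
exact/is_derive_mulcl/is_derive_radial/Ck2_partial.
Qed.

End derivatives_on_spheres.

(** * Rotation fields and their skew-adjointness *)

Section angular_derivative.
Context (R : realType) (m : nat).
Context (i j : 'I_m).
Context (ij : i != j).
Implicit Types (u f : 'rV[R]_m -> R) (x y : 'rV[R]_m).

Definition ang f y : R := y 0 i * partial j f y - y 0 j * partial i f y.

(** This is [L^2 f] for the rotation field [L] of [ang], expanded by the product rule with
    [L y_i = - y_j] and [L y_j = y_i], so that only partials of [f] get differentiated. *)
Definition ang2 f y : R :=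
  (y 0 i * ang (partial j f) y - y 0 j * partial j f y) -
  (y 0 j * ang (partial i f) y + y 0 i * partial i f y).

Let R_ (t : R) x := plane_rot i j (cos t) (sin t) x.

Lemma plane_rot0 x : plane_rot i j (cos 0) (sin 0) x = x.
Proof.
apply/rowP => k; rewrite !mxE cos0 sin0 !mul1r !mul0r subr0 add0r.
by have [->//|_] := eqVneq k i; have [->|] := eqVneq k j.
Qed.

Lemma is_derive_plane_rot_coord (t : R) x k :
  is_derive t 1 (fun s : R => plane_rot i j (cos s) (sin s) x 0 k)
    (if k == i then - R_ t x 0 j else if k == j then R_ t x 0 i else 0).
Proof.
have ji : j != i by rewrite eq_sym.
rewrite /R_ !mxE !eqxx (negPf ji).
under eq_fun do rewrite mxE.
have [_|_] := eqVneq k i.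
  rewrite (_ : (fun s => _) = fun s => x 0 i * cos s + (- x 0 j) * sin s); last first.
    by apply/funext => s; ring.
  apply: is_derive_eq (is_derive_addf (is_derive_mulcl _ (is_derive_cos t))
    (is_derive_mulcl _ (is_derive_sin t))) _; ring.
have [_|_] := eqVneq k j; last exact: is_derive_cst.
rewrite (_ : (fun s => _) = fun s => x 0 i * sin s + x 0 j * cos s); last first.
  by apply/funext => s; ring.
apply: is_derive_eq (is_derive_addf (is_derive_mulcl _ (is_derive_sin t))
  (is_derive_mulcl _ (is_derive_cos t))) _; ring.
Qed.

Lemma is_derive_plane_rot f (t : R) x : Ck 1 f ->
  is_derive t 1 (fun s : R => f (plane_rot i j (cos s) (sin s) x)) (ang f (R_ t x)).
Proof.
move=> C1f; have ji : j != i by rewrite eq_sym.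
apply: is_derive_eq (is_derive_comp_row C1f (is_derive_plane_rot_coord t x)) _.
rewrite (bigD1 i)//= (bigD1 j)//= big1 => [|k /andP[/negPf ki /negPf kj]]; last first.
  by rewrite ki kj mul0r.
by rewrite !eqxx (negPf ji) addr0 addrC mulNr.
Qed.

Lemma is_derive_ang_plane_rot f (t : R) x : Ck 2 f ->
  is_derive t 1 (fun s : R => ang f (plane_rot i j (cos s) (sin s) x))
    (ang2 f (R_ t x)).
Proof.
move=> C2f; have ji : j != i by rewrite eq_sym.
have Hi := is_derive_plane_rot_coord t x i.
have Hj := is_derive_plane_rot_coord t x j.
rewrite eqxx in Hi; rewrite eqxx (negPf ji) in Hj.
have Hpi := is_derive_plane_rot t x (@Ck2_partial _ _ _ i C2f).
have Hpj := is_derive_plane_rot t x (@Ck2_partial _ _ _ j C2f).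
have H := is_derive_addf (is_derive_mulf Hi Hpj)
  (is_derive_mulcl (-1) (is_derive_mulf Hj Hpi)).
rewrite (_ : (fun s => _) = fun s : R =>
  plane_rot i j (cos s) (sin s) x 0 i * partial j f (plane_rot i j (cos s) (sin s) x) +
  -1 * (plane_rot i j (cos s) (sin s) x 0 j *
        partial i f (plane_rot i j (cos s) (sin s) x))); last first.
  by apply/funext => s; rewrite mulN1r.
apply: is_derive_eq H _.
by rewrite mulN1r mulNr [- _ + _]addrC [X in _ - X]addrC.
Qed.

Lemma continuous_ang f : Ck 1 f -> continuous (ang f).
Proof.
by move=> C1f; apply: continuous_sub; apply: continuous_mul;
  [exact: coord_continuous|exact: Ck1_partial_continuous|
   exact: coord_continuous|exact: Ck1_partial_continuous].
Qed.

Lemma continuous_ang2 f : Ck 2 f -> continuous (ang2 f).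
Proof.
move=> C2f.
have ca k : continuous (ang (partial k f)) by exact/continuous_ang/Ck2_partial.
have cp k : continuous (partial k f) by exact/Ck1_partial_continuous/Ck2_Ck1.
have cc k : continuous (fun y : 'rV[R]_m => y 0 k) by exact: coord_continuous.
by apply: continuous_sub; [apply: continuous_sub|apply: continuous_add];
  exact: continuous_mul.
Qed.

Lemma continuous_plane_rot_joint (r : R) :
  continuous (fun p : R * 'rV[R]_m => R_ p.1 (r *: p.2)).
Proof.
have cc k : continuous (fun p : R * 'rV[R]_m => (r *: p.2) 0 k).
  rewrite (_ : (fun p => _) = fun p : R * 'rV[R]_m => r * p.2 0 k).
    by apply: continuous_mul; [exact: cst_continuous|exact: continuous_coord2].
  by apply/funext => p; rewrite mxE.
have ccos : continuous (fun p : R * 'rV[R]_m => cos p.1).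
  by move=> p; apply: (@cvg_comp _ _ _ fst cos); [exact: cvg_fst|exact: continuous_cos].
have csin : continuous (fun p : R * 'rV[R]_m => sin p.1).
  by move=> p; apply: (@cvg_comp _ _ _ fst sin); [exact: cvg_fst|exact: continuous_sin].
apply: continuous_row => k.
rewrite (_ : (fun p => _) = fun p : R * 'rV[R]_m =>
  if k == i then cos p.1 * (r *: p.2) 0 i - sin p.1 * (r *: p.2) 0 j
  else if k == j then sin p.1 * (r *: p.2) 0 i + cos p.1 * (r *: p.2) 0 j
  else (r *: p.2) 0 k); last by apply/funext => p; rewrite mxE.
case: (k == i); first by apply: continuous_sub; exact: continuous_mul.
case: (k == j); first by apply: continuous_add; exact: continuous_mul.
exact: cc.
Qed.

(* Integration by parts: the rotation field is skew-adjoint because rotations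
   preserve the sphere measure. *)
Lemma sint_ang2_le0 u (r : R) : Ck 2 u ->
  sint (fun x => u (r *: x) * ang2 u (r *: x)) <= 0.
Proof.
move=> C2u.
have cu := Ck_continuous C2u.
have ca := continuous_ang (Ck2_Ck1 C2u).
have ca2 := continuous_ang2 C2u.
have cr : continuous (fun x : 'rV[R]_m => r *: x).
  by move=> x; exact: scaler_continuous.
(* [df] is [L f], the angular derivative of [f]; its integral is shown to vanish, and its first term
   is a square. *)
pose f y := u y * ang u y.
pose df y := ang u y * ang u y + u y * ang2 u y.
have cf : continuous f by exact: continuous_mul.
have cdf : continuous df by apply: continuous_add; exact: continuous_mul.
pose F (p : R * 'rV[R]_m) := f (R_ p.1 (r *: p.2)).
pose dF (p : R * 'rV[R]_m) := df (R_ p.1 (r *: p.2)).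
have cF : continuous F.
  exact: (continuous_comp_fun (@continuous_plane_rot_joint r) cf).
have cdF : continuous dF.
  exact: (continuous_comp_fun (@continuous_plane_rot_joint r) cdf).
have FdF (s : R) x : is_derive s 1 (fun s : R => F (s, x)) (dF (s, x)).
  have H1 := is_derive_plane_rot s (r *: x) (Ck2_Ck1 C2u).
  have H2 := is_derive_ang_plane_rot s (r *: x) C2u.
  exact: is_derive_mulf H1 H2.
have [_ D0] := is_derive_sint 0 cF cdF FdF.
(* Constancy near angle 0 determines the derivative there, and near 0 the cosine is positive, which
   gives [1 + cos t != 0] for [sint_rot]. *)
have Fcst : \forall t \near (0 : R),
    sint (fun x => F (t, x)) = sint (fun x => f (r *: x)).
  near=> t.
  have ct : 0 < cos t.
    by near: t; apply: (cvgr_gt _ (@continuous_cos R 0)); rewrite cos0.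
  have c1 : 1 + cos t != 0 by rewrite gt_eqF// addr_gt0.
  have cfr : continuous (fun x => f (r *: x)) by exact: continuous_comp_fun cr cf.
  rewrite -[RHS](sint_rot ij (cos2Dsin2 t) c1 cfr).
    by apply: eq_sint => x _; rewrite /F /R_ /= plane_rotZ.
  rewrite (_ : _ \o _ = fun x => F (t, x)).
    apply: (continuous_comp_fun _ cF).
    by apply: (@continuous_pair _ _ _ (fun=> t) id) => x;
      [exact: cst_continuous|exact: cvg_id].
  by apply/funext => x; rewrite /F /R_ /= plane_rotZ.
have : sint (fun x => dF (0, x)) = 0.
  by rewrite -D0 (near_eq_derive _ Fcst) derive_cst.
rewrite (_ : (fun x => _) = fun x => ang u (r *: x) * ang u (r *: x) +
    u (r *: x) * ang2 u (r *: x)); last first.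
  by apply/funext => x; rewrite /dF /R_/= plane_rot0.
rewrite sintD; last 2 first.
- by apply: continuous_mul; exact: continuous_comp_fun cr ca.
- apply: continuous_mul; first exact: continuous_comp_fun cr cu.
  exact: continuous_comp_fun cr ca2.
move/eqP; rewrite addrC addr_eq0 => /eqP ->.
by rewrite oppr_le0; apply: sint_ge0 => x; rewrite -expr2 sqr_ge0.
Unshelve. all: by end_near. Qed.

End angular_derivative.

(** * The angular Laplacian and the energy inequality *)

Section energy.
Context (R : realType) (m : nat).
Implicit Types (u f : 'rV[R]_m -> R) (x y : 'rV[R]_m).

Lemma sint_sum (I : Type) (s : seq I) (P : pred I) (f : I -> 'rV[R]_m -> R) :
  (forall i, P i -> continuous (f i)) ->
  sint (fun x => \sum_(i <- s | P i) f i x) = \sum_(i <- s | P i) sint (f i).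
Proof.
move=> cf; elim: s => [|i s IH].
  transitivity (0 * sint (fun _ : 'rV[R]_m => 1)).
    rewrite -sintZ; last exact: cst_continuous.
    by apply: eq_sint => x _; rewrite big_nil mul0r.
  by rewrite big_nil mul0r.
rewrite big_cons; case: ifPn => Pi; last first.
  by rewrite -IH; apply: eq_sint => x _; rewrite big_cons (negPf Pi).
rewrite -IH -sintD; [|exact: cf|].
  by apply: eq_sint => x _; rewrite big_cons Pi.
rewrite (_ : (fun x => _) = fun x => \sum_(k <- s) (if P k then f k x else 0)).
  apply: continuous_sum => k; have [Pk|_] := boolP (P k); first exact: cf.
  exact: cst_continuous.
by apply/funext => x; rewrite big_mkcond.
Qed.

Lemma partial_sqr_enorm (c : R) y i :
  partial i (fun y => enorm y ^+ 2 / c) y = 2 * y 0 i / c.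
Proof.
pose g (t : R) := (enorm y ^+ 2 + (2 * y 0 i * t + t * t)) / c.
have gE h : enorm (h *: delta_mx 0 i + y) ^+ 2 / c = g h.
  congr (_ / _); rewrite !sqr_enorm (bigD1 i)//= [X in _ = X + _](bigD1 i)//=.
  rewrite !mxE !eqxx mulr1 [X in _ + X = _](eq_bigr (fun k => y 0 k ^+ 2)); last first.
    by move=> k /negPf ki; rewrite !mxE eqxx ki mulr0 add0r.
  ring.
rewrite /partial /derive.
rewrite (_ : (fun h : R => _) = fun h => h^-1 *: ((g \o shift 0) (h *: 1) - g 0)).
  have H0 : is_derive (0 : R) 1 (fun t : R => t) 1 by exact: is_derive_id.
  have H : is_derive (0 : R) 1 g (2 * y 0 i / c).
    rewrite (_ : g = fun t =>
        c^-1 * (enorm y ^+ 2 + (2 * y 0 i * t + t * t))); last first.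
      by apply/funext => t; rewrite /g mulrC.
    apply: is_derive_eq (is_derive_mulcl _ (is_derive_addf (is_derive_cst _ _ _)
      (is_derive_addf (is_derive_mulcl _ H0) (is_derive_mulf H0 H0)))) _.
    ring.
  by have [_ <-] := H.
apply/funext => h /=; rewrite gE addr0 [h *: 1]mulr1 -(gE 0).
by rewrite scale0r add0r.
Qed.

(** The exponential factor never vanishes, so the bracket does; the gradient of [|y|^2 / 4] is
    [y / 2]. *)
Lemma quasi_harmonicE u y : (2 < m)%N -> quasi_harmonic u ->
  \sum_i partial i (partial i u) y = 2^-1 * \sum_i y 0 i * partial i u y.
Proof.
move=> m2 [C2u /(_ y)]; rewrite laplace_beltrami_qh_metricE//.
move/eqP; rewrite mulf_eq0 gt_eqF ?expR_gt0//= subr_eq0 => /eqP ->.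
rewrite mulr_sumr; apply: eq_bigr => i _; rewrite partial_sqr_enorm mulrA.
by congr (_ * _); field.
Qed.

(* With [a], [p], [q] the coordinates, first and second partial derivatives at a point,
   the summand is [ang2 i j]. *)
Lemma sum_rotation_symbols (a p : 'I_m -> R) (q : 'I_m -> 'I_m -> R) :
  \sum_i \sum_(j | j != i)
    ((a i * (a i * q j j - a j * q i j) - a j * p j)
     - (a j * (a i * q j i - a j * q i i) + a i * p i)) =
  2 * ((\sum_i a i ^+ 2) * (\sum_i q i i) - \sum_i \sum_j a i * a j * q j i
       - (m%:R - 1) * \sum_i a i * p i).
Proof.
set N := \sum_i a i ^+ 2; set L := \sum_i q i i.
set X2 := \sum_i \sum_j _; set X := \sum_i a i * p i.
have e1 : \sum_i \sum_j a i ^+ 2 * q j j = N * L.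
  by rewrite /N mulr_suml; apply: eq_bigr => i _; rewrite mulr_sumr.
have e2 : \sum_i \sum_j a j ^+ 2 * q i i = N * L by rewrite exchange_big.
have e3 : \sum_i \sum_j a i * a j * q i j = X2.
  rewrite exchange_big; apply: eq_bigr => i _; apply: eq_bigr => j _.
  by rewrite [a j * _]mulrC.
have e4 : \sum_(i < m) \sum_j a j * p j = m%:R * X.
  by rewrite sumr_const card_ord mulr_natl.
have e5 : \sum_i \sum_(j < m) a i * p i = m%:R * X by rewrite exchange_big.
(* Completing the inner sum by its diagonal term [j = i], which equals [- 2 a_i p_i], requires the
   correction [2 a_i p_i]; this turns [m] into [m - 1]. *)
transitivity (\sum_i ((\sum_j (a i ^+ 2 * q j j + a j ^+ 2 * q i i
    - (a i * a j * q i j + a i * a j * q j i) - (a j * p j + a i * p i)))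
    + 2 * (a i * p i))).
  apply: eq_bigr => i _; rewrite [X in _ = X + _](bigD1 i)//=.
  rewrite [RHS]addrAC (_ : _ + 2 * _ = 0) ?add0r; last by ring.
  by apply: eq_bigr => j _; ring.
rewrite big_split/= -mulr_sumr -/X.
under eq_bigr => i _ do rewrite !(sumrB, big_split)/=.
by rewrite !(sumrB, big_split)/= e1 e2 e3 e4 e5 -/X2; ring.
Qed.

(** Summing [sint_ang2_le0] over ordered pairs gives that [2 u (r^2 Delta u - r^2 u_rr - (m-1) r
    u_r)] has integral at most 0, and the equation replaces [Delta u] by [(r/2) u_r]. *)
Lemma energy_inequality u (r : R) : (2 < m)%N -> quasi_harmonic u ->
  (r ^+ 3 - 2 * (m%:R - 1) * r) * sint (fun x => u (r *: x) * radial u (r, x))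
  <= 2 * r ^+ 2 * sint (fun x => u (r *: x) * radial2 u (r, x)).
Proof.
move=> m2 qu; have [C2u _] := qu.
have cr : continuous (fun x : 'rV[R]_m => r *: x) by exact: scaler_continuous.
have cu : continuous (fun x => u (r *: x)).
  exact: continuous_comp_fun cr (Ck_continuous C2u).
have cpair : continuous (fun x : 'rV[R]_m => (r, x)).
  by apply: (@continuous_pair _ _ _ (fun=> r) id) => x;
    [exact: cst_continuous|exact: cvg_id].
have c1 : continuous (fun x => u (r *: x) * radial u (r, x)).
  apply: continuous_mul => //.
  exact: (continuous_comp_fun cpair (continuous_radial (Ck2_Ck1 C2u))).
have c2 : continuous (fun x => u (r *: x) * radial2 u (r, x)).
  apply: continuous_mul => //.
  exact: (continuous_comp_fun cpair (continuous_radial2 C2u)).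
have ca i j : i != j -> continuous (fun x => u (r *: x) * ang2 i j u (r *: x)).
  move=> ij; apply: continuous_mul => //.
  exact: continuous_comp_fun cr (continuous_ang2 C2u).
have : sint (fun x => \sum_i \sum_(j | j != i) u (r *: x) * ang2 i j u (r *: x)) <= 0.
  rewrite sint_sum; last first.
    move=> i _.
    rewrite (_ : (fun x => _) = fun x => \sum_j
        if j != i then u (r *: x) * ang2 i j u (r *: x) else 0).
      apply: continuous_sum => j.
      have [ji|_] := boolP (j != i); last exact: cst_continuous.
      by apply: ca; rewrite eq_sym.
    by apply/funext => x; rewrite big_mkcond.
  apply: sumr_le0 => i _; rewrite sint_sum; last first.
    by move=> j ji; apply: ca; rewrite eq_sym.
  by apply: sumr_le0 => j ji; apply: sint_ang2_le0 => //; rewrite eq_sym.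
rewrite (@eq_sint _ _ _ (fun x =>
    (r ^+ 3 - 2 * (m%:R - 1) * r) * (u (r *: x) * radial u (r, x)) +
    - (2 * r ^+ 2) * (u (r *: x) * radial2 u (r, x)))).
  rewrite sintD ?sintZ//; last 2 first.
  - by apply: continuous_mul => //; exact: cst_continuous.
  - by apply: continuous_mul => //; exact: cst_continuous.
  by rewrite mulNr subr_le0.
move=> x x1.
have Xr : \sum_i (r *: x) 0 i * partial i u (r *: x) = r * radial u (r, x).
  by rewrite mulr_sumr; apply: eq_bigr => i _; rewrite mxE mulrA.
have X2r : \sum_i \sum_j (r *: x) 0 i * (r *: x) 0 j *
    partial j (partial i u) (r *: x) = r ^+ 2 * radial2 u (r, x).
  rewrite mulr_sumr; apply: eq_bigr => i _; rewrite /radial !mulr_sumr.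
  by apply: eq_bigr => j _; rewrite !mxE/=; move: (partial _ _ _) => a; ring.
have Nr : \sum_i (r *: x) 0 i ^+ 2 = r ^+ 2.
  rewrite -sqr_enorm enormZ x1 mulr1 real_normK ?num_real//.
under eq_bigr => i _ do rewrite -mulr_sumr.
rewrite -mulr_sumr sum_rotation_symbols Nr quasi_harmonicE// Xr X2r.
by move: (u _) (radial _ _) (radial2 _ _) => a b c; field.
Qed.

End energy.

(** * Growth of the spherical means *)

Section growth.
Context (R : realType).

(** The sign condition concerns the open interval, so that [a] may be the origin, where estimates
    divided by the radius say nothing. *)
Lemma ge0_derive_le (f df : R -> R) (a b : R) : a <= b ->
  (forall t : R, a <= t <= b -> is_derive t 1 f (df t)) ->
  (forall t, a < t < b -> 0 <= df t) -> f a <= f b.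
Proof.
rewrite le_eqVlt => /orP[/eqP -> //|ab] fdf df0.
have cf : {within `[a, b], continuous f}.
  apply: derivable_within_continuous => t; rewrite in_itv/= => /fdf.
  by case.
have dab t : t \in `]a, b[ -> is_derive t 1 f (df t).
  by rewrite in_itv/= => /andP[ta tb]; apply: fdf; rewrite !ltW.
have [c cab E] := MVT ab dab cf.
rewrite -subr_ge0 E mulr_ge0 ?subr_ge0 ?(ltW ab)//; apply: df0.
by rewrite in_itv in cab.
Qed.

(** Taken with [k] the dimension, this is the borderline growth: up to a constant it minorizes a
    primitive of [1 / P]. *)
Definition comparison (k : nat) (t : R) : R := expR (t ^+ 2 / 4) / t ^+ k.

Lemma is_derive_pow (n : nat) (t : R) :
  is_derive t 1 (fun s : R => s ^+ n) (n%:R * t ^+ n.-1).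
Proof.
by apply: DeriveDef; [exact: exprn_derivable|rewrite exp_derive [_ *: _]mulr1].
Qed.

Lemma is_derive_pow_expR (k : nat) (c t : R) :
  is_derive t 1 (fun s : R => s ^+ k.+1 * expR (c * s ^+ 2))
    ((k.+1%:R * t ^+ k + 2 * c * t * t ^+ k.+1) * expR (c * t ^+ 2)).
Proof.
have H1 : is_derive t 1 (fun s : R => s ^+ k.+1) (k.+1%:R * t ^+ k).
  exact: is_derive_pow.
have H2 : is_derive t 1 (fun s : R => s ^+ 2) (2 * t).
  by apply: is_derive_eq (is_derive_pow 2 t) _; rewrite expr1.
have H3 := @is_derive1_comp _ expR (fun s => c * s ^+ 2) t _ _
  (is_derive_expR _) (is_derive_mulcl c H2).
apply: is_derive_eq (is_derive_mulf H1 H3) _; rewrite /=; ring.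
Qed.

Lemma is_derive_comparison (k : nat) (t : R) : 0 < t ->
  is_derive t 1 (comparison k.+1) ((t / 2 - k.+1%:R / t) * comparison k.+1 t).
Proof.
move=> t0; have tk : t ^+ k.+1 != 0 by rewrite expf_neq0// gt_eqF.
have H2 : is_derive t 1 (fun s : R => s ^+ 2) (2 * t).
  by apply: is_derive_eq (is_derive_pow 2 t) _; rewrite expr1.
have H3 := @is_derive1_comp _ expR (fun s => 4^-1 * s ^+ 2) t _ _
  (is_derive_expR _) (is_derive_mulcl 4^-1 H2).
have H1 : is_derive t 1 (fun s : R => s ^+ k.+1) (k.+1%:R * t ^+ k).
  exact: is_derive_pow.
have H4 := @is_deriveV _ (fun s => s ^+ k.+1) t _ _ tk H1.
have H := is_derive_mulf H3 H4.
rewrite (_ : comparison k.+1 = fun s : R =>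
    expR (4^-1 * s ^+ 2) * (s ^+ k.+1)^-1); last first.
  by apply/funext => s; rewrite /comparison mulrC [_ / 4]mulrC mulrC.
apply: is_derive_eq H _; rewrite /= /comparison [4^-1 * _]mulrC.
rewrite -[_ *: _]/(- t ^+ k.+1 ^- 2 * (k.+1%:R * t ^+ k)).
move: (expR _) tk => E; rewrite exprS mulf_eq0 negb_or => /andP[tn0 tk].
move: (t ^+ k) tk => q q0; field.
by rewrite tn0 q0.
Qed.

(* With [P t = t^(k+1) e^(-t^2/4)] the hypotheses give [(P K)' >= P Q >= 0] and,
   by the Cauchy-Schwarz bound, that [(P K)^2 / I], which is the square of
   [P (sqrt I)'], is nondecreasing. Hence [(sqrt I)' >= c / P] from some point on. *)
Lemma energy_growth (k : nat) (I K Kd Q : R -> R) :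
  (forall t : R, is_derive t 1 I (2 * K t)) ->
  (forall t : R, is_derive t 1 K (Kd t)) ->
  (forall t, 0 <= I t) -> (forall t, 0 <= Q t) ->
  (forall t, K t ^+ 2 <= I t * Q t) ->
  (forall t, 0 < t -> (t / 2 - k.+1%:R / t) * K t + Q t <= Kd t) ->
  (exists2 t, 0 < t & 0 < Q t) ->
  exists c a, [/\ 0 < c, 0 < a & forall t, a <= t ->
    c * (comparison k.+2 t - comparison k.+2 a) <= Num.sqrt (I t)].
Proof.
move=> dI dK I0 Q0 CS Kd_ge [t1 t1_gt0 Qt1].
pose P (t : R) := t ^+ k.+1 * expR (- 4^-1 * t ^+ 2).
pose P' (t : R) := (k.+1%:R * t ^+ k + 2 * - 4^-1 * t * t ^+ k.+1) *
  expR (- 4^-1 * t ^+ 2).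
have dP (t : R) : is_derive t 1 P (P' t) by exact: is_derive_pow_expR.
have P_gt0 t : 0 < t -> 0 < P t by move=> t0; rewrite mulr_gt0 ?exprn_gt0 ?expR_gt0.
have P'E t : 0 < t -> P' t = (k.+1%:R / t - t / 2) * P t.
  move=> t0; rewrite /P' /P exprS; move: (expR _) (t ^+ k) => E q; field.
  by rewrite gt_eqF.
pose W t := P t * K t; pose W' t := P' t * K t + P t * Kd t.
have dW (t : R) : is_derive t 1 W (W' t) by exact: is_derive_mulf.
have W'_ge t : 0 < t -> P t * Q t <= W' t.
  move=> t0; rewrite /W' P'E//.
  rewrite -lerBlDl.
  rewrite (_ : _ - _ = P t * ((t / 2 - k.+1%:R / t) * K t + Q t)); last by ring.
  by rewrite ler_pM2l ?P_gt0// Kd_ge.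
have W_mono a b : 0 <= a -> a <= b -> W a <= W b.
  move=> a0 ab; apply: (ge0_derive_le ab (fun t _ => dW t)) => t /andP[at_ _].
  have t0 := le_lt_trans a0 at_.
  by rewrite (le_trans _ (W'_ge _ t0))// mulr_ge0// ltW// P_gt0.
have W_0 : W 0 = 0 by rewrite /W /P expr0n !mul0r.
(* Otherwise [W], nondecreasing from [W 0 = 0], would vanish for all positive radii, and so would
   [W' t1], against [W' t1 >= P t1 * Q t1 > 0]. *)
have [r0 r0_gt0 Wr0] : exists2 r0, 0 < r0 & 0 < W r0.
  apply: contrapT => Wn.
  have W_eq0 t : 0 < t -> W t = 0.
    move=> t0; have Wt0 : 0 <= W t by rewrite -W_0 W_mono// ltW.
    apply/eqP; rewrite eq_le Wt0 andbT leNgt.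
    by apply/negP => Wt; apply: Wn; exists t.
  have : 'D_1 W t1 = 0.
    rewrite (@near_eq_derive _ _ _ _ (cst 0)) ?derive_cst//.
    near=> t; apply: W_eq0; near: t; exact: lt_nbhsr.
  have [_ ->] := dW t1 => W'0.
  have := W'_ge _ t1_gt0; rewrite W'0 leNgt mulr_gt0//.
  exact: P_gt0.
have W_gt0 t : r0 <= t -> 0 < W t.
  by move=> r0t; apply: lt_le_trans Wr0 (W_mono _ _ (ltW r0_gt0) r0t).
have t_gt0 t : r0 <= t -> 0 < t by exact: lt_le_trans.
have K_gt0 t : r0 <= t -> 0 < K t.
  by move=> r0t; rewrite -(pmulr_rgt0 _ (P_gt0 _ (t_gt0 _ r0t))) W_gt0.
have I_gt0 t : r0 <= t -> 0 < I t.
  move=> r0t; rewrite lt_neqAle I0 andbT; apply/eqP => It.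
  by have := CS t; rewrite -It mul0r leNgt exprn_gt0// K_gt0.
have V_mono t : r0 <= t -> W r0 ^+ 2 / I r0 <= W t ^+ 2 / I t.
  move=> r0t.
  pose V' s := (2 * W s * W' s) / I s - W s ^+ 2 * (2 * K s) / I s ^+ 2.
  apply: (@ge0_derive_le (fun s => W s ^+ 2 / I s) V') => // s /andP[r0s _].
    have Is : I s != 0 by rewrite gt_eqF// I_gt0.
    have H := is_derive_mulf (is_derive_mulf (dW s) (dW s))
      (@is_deriveV _ I s _ _ Is (dI s)).
    rewrite (_ : (fun s => _) = fun s => (W s * W s) * (I s)^-1); last first.
      by apply/funext => q; rewrite expr2.
    apply: is_derive_eq H _; rewrite /GRing.scale/= /V'.
    by move: (W s) (W' s) (K s) (I s) Is => a b c d d0; field.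
  have {}r0s := ltW r0s.
  have Is := I_gt0 s r0s.
  rewrite /V' (_ : _ - _ = 2 * W s * (W' s * I s - W s * K s) / I s ^+ 2); last first.
    move: (W s) (W' s) (K s) (I s) Is => a b c d d0; field.
    by rewrite gt_eqF.
  apply: divr_ge0; last by rewrite sqr_ge0.
  apply: mulr_ge0; first by rewrite mulr_ge0// ltW// W_gt0.
  (* The chain is [W K = P K^2 <= P Q I <= W' I]. *)
  rewrite subr_ge0; apply: (@le_trans _ _ (P s * Q s * I s)).
    rewrite /W -[leLHS]mulrA -[leRHS]mulrA ler_pM2l ?P_gt0 ?t_gt0//.
    by rewrite -expr2 [leRHS]mulrC CS.
  by rewrite ler_pM2r// W'_ge// t_gt0.
(* Since [(sqrt I)' = K / sqrt I], this is the value of [P (sqrt I)'] at [r0]. *)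
pose c := Num.sqrt (W r0 ^+ 2 / I r0).
have c_gt0 : 0 < c by rewrite sqrtr_gt0 divr_gt0 ?exprn_gt0 ?W_gt0 ?I_gt0.
have c_le t : r0 <= t -> c * Num.sqrt (I t) <= W t.
  move=> r0t; rewrite -[leRHS]gtr0_norm ?W_gt0// -sqrtr_sqr -sqrtrM; last first.
    by rewrite divr_ge0 ?sqr_ge0 ?I0.
  rewrite ler_wsqrtr// -ler_pdivlMr ?I_gt0//; exact: V_mono.
(* The factor 2: with [B] the comparison function, [1 / P = s B] and [B' <= (s/2) B], hence
   [(2 c B)' <= c / P <= (sqrt I)']. *)
exists (2 * c), r0; split => //; first by rewrite mulr_gt0.
move=> t r0t; rewrite mulrBr lerBlDr.
pose B := comparison k.+2.
(* The initial value [sqrt (I r0)] is nonnegative and gets dropped. *)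
suff : Num.sqrt (I r0) - 2 * c * B r0 <= Num.sqrt (I t) - 2 * c * B t.
  by have := sqrtr_ge0 (I r0); rewrite -/B; lra.
pose D' s := K s / Num.sqrt (I s) - 2 * c * ((s / 2 - k.+2%:R / s) * B s).
apply: (@ge0_derive_le (fun s => Num.sqrt (I s) - 2 * c * B s) D') => // s /andP[r0s _].
  have H1 := @is_derive1_comp _ Num.sqrt I s _ _ (is_derive1_sqrt (I_gt0 _ r0s)) (dI s).
  have H2 := is_derive_comparison k.+1 (t_gt0 _ r0s).
  have H := is_derive_addf H1 (is_derive_mulcl (- (2 * c)) H2).
  rewrite (_ : (fun s => _) = fun s => Num.sqrt (I s) + - (2 * c) * B s); last first.
    by apply/funext => q; rewrite mulNr.
  apply: is_derive_eq H _; rewrite /D' mulNr; congr (_ - _).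
  have : Num.sqrt (I s) != 0 by rewrite gt_eqF// sqrtr_gt0 I_gt0// ltW.
  by move: (Num.sqrt _) (K s) => a b a0; field.
have {}r0s := ltW r0s.
have s0 := t_gt0 _ r0s.
have B_gt0 : 0 < B s by rewrite divr_gt0 ?expR_gt0 ?exprn_gt0.
have PB : P s * (s * B s) = 1.
  rewrite /P /B /comparison mulNr expRN [4^-1 * _]mulrC [s ^+ k.+2]exprS.
  have := expR_gt0 (s ^+ 2 / 4); move: (expR _) => E E0.
  have : s ^+ k.+1 != 0 by rewrite expf_neq0// gt_eqF.
  move: (s ^+ k.+1) => q q0; field.
  by rewrite q0 !gt_eqF.
have : c * (s * B s) <= K s / Num.sqrt (I s).
  rewrite ler_pdivlMr ?sqrtr_gt0 ?I_gt0// -(ler_pM2l (P_gt0 _ s0)).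
  apply: le_trans (c_le _ r0s).
  rewrite (_ : P s * _ = (P s * (s * B s)) * (c * Num.sqrt (I s))); last by ring.
  by rewrite PB mul1r.
rewrite /D' subr_ge0; apply: le_trans.
rewrite (_ : c * (s * B s) = 2 * c * (s / 2 * B s)); last by field.
rewrite ler_pM2l ?mulr_gt0// ler_pM2r//.
by rewrite gerBl divr_ge0// ltW.
Unshelve. all: by end_near. Qed.
End growth.

(** One term of the exponential series, of degree [n + 1] in [t^2 / 4], already outweighs [t^n]. The
    linear bound gives an explicit radius beyond which [comparison] exceeds a given value. *)
Lemma comparison_ge (R : realType) (n : nat) (t : R) : 1 <= t ->
  t / (4 ^+ n.+1 * n.+1`!%:R) <= comparison n t.
Proof.
move=> t1; have t0 : 0 < t := lt_le_trans ltr01 t1.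
have E : (t ^+ 2 / 4) ^+ n.+1 / n.+1`!%:R <= expR (t ^+ 2 / 4).
  apply: le_trans (expR_ge1Dxn n _); first by rewrite lerDr.
  by rewrite divr_ge0// sqr_ge0.
rewrite /comparison ler_pdivlMr ?exprn_gt0//; apply: le_trans E.
have f0 : 0 < n.+1`!%:R :> R by rewrite ltr0n fact_gt0.
have -> : (t ^+ 2 / 4) ^+ n.+1 / n.+1`!%:R =
    t ^+ 2 ^+ n.+1 / (4 ^+ n.+1 * n.+1`!%:R) by rewrite expr_div_n invfM mulrA.
rewrite mulrAC ler_pM2r ?invr_gt0 ?mulr_gt0 ?exprn_gt0//.
by rewrite -exprS -exprM ler_weXn2l// leq_pmull.
Qed.

Lemma discriminant_le (R : realFieldType) (a b c : R) : 0 <= a ->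
  (forall s, 0 <= s ^+ 2 * a + 2 * s * b + c) -> b ^+ 2 <= a * c.
Proof.
rewrite le_eqVlt => /orP[/eqP <- H|a0 H].
  have [-> |b0] := eqVneq b 0; first by rewrite expr0n mul0r.
  (* For [a = 0] the expression is affine in [s], and this [s] gives it the value -1. *)
  have := H (- (c + 1) / (2 * b)); rewrite mulr0 add0r.
  rewrite (_ : _ + c = -1) ?ler0N1//.
  by field.
(* The minimizer of the quadratic. *)
have := H (- b / a).
rewrite (_ : _ + c = (a * c - b ^+ 2) / a); last by field; rewrite gt_eqF.
by rewrite pmulr_lge0 ?invr_gt0// subr_ge0.
Qed.

(** * The spherical means of a [C^2] function *)

Section spherical_mean.
Context (R : realType) (m : nat) (u : 'rV[R]_m -> R).
Context (C2u : Ck 2 u).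

(** The three means are [I], [K] and [Q] of the overview, in this order. *)
Definition mean_sqr (t : R) := sint (fun x => u (t *: x) * u (t *: x)).
Definition mean_flux (t : R) := sint (fun x => u (t *: x) * radial u (t, x)).
Definition mean_radial_sqr (t : R) :=
  sint (fun x => radial u (t, x) * radial u (t, x)).

Let cscale : continuous (fun p : R * 'rV[R]_m => u (p.1 *: p.2)).
Proof.
exact: continuous_comp_fun (@continuous_scale_row R m) (Ck_continuous C2u).
Qed.

Let crad := continuous_radial (Ck2_Ck1 C2u).
Let crad2 := continuous_radial2 C2u.

Let cpair (t : R) : continuous (fun x : 'rV[R]_m => (t, x)).
Proof.
by apply: (@continuous_pair _ _ _ (fun=> t) id) => x;
  [exact: cst_continuous|exact: cvg_id].
Qed.

Let cu (t : R) : continuous (fun x : 'rV[R]_m => u (t *: x)).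
Proof.
have cs : continuous (fun x : 'rV[R]_m => t *: x) by exact: scaler_continuous.
exact: continuous_comp_fun cs (Ck_continuous C2u).
Qed.

Let crt (t : R) : continuous (fun x : 'rV[R]_m => radial u (t, x)).
Proof. exact: (continuous_comp_fun (@cpair t) crad). Qed.

Let cr2t (t : R) : continuous (fun x : 'rV[R]_m => radial2 u (t, x)).
Proof. exact: (continuous_comp_fun (@cpair t) crad2). Qed.

Lemma is_derive_mean_sqr (t : R) : is_derive t 1 mean_sqr (2 * mean_flux t).
Proof.
pose F (p : R * 'rV[R]_m) := u (p.1 *: p.2) * u (p.1 *: p.2).
pose dF (p : R * 'rV[R]_m) := 2 * (u (p.1 *: p.2) * radial u p).
have cF : continuous F by exact: continuous_mul.
have cdF : continuous dF.
  by apply: continuous_mul; [exact: cst_continuous|exact: continuous_mul].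
have FdF (s : R) x : is_derive s 1 (fun s : R => F (s, x)) (dF (s, x)).
  have H := is_derive_radial s x (Ck2_Ck1 C2u).
  apply: is_derive_eq (is_derive_mulf H H) _; rewrite /dF/=.
  by move: (u _) (radial _ _) => a b; ring.
apply: is_derive_eq (is_derive_sint t cF cdF FdF) _.
rewrite /dF/= sintZ//; exact: continuous_mul (@cu t) (@crt t).
Qed.

Lemma is_derive_mean_flux (t : R) : is_derive t 1 mean_flux
  (mean_radial_sqr t + sint (fun x => u (t *: x) * radial2 u (t, x))).
Proof.
pose F (p : R * 'rV[R]_m) := u (p.1 *: p.2) * radial u p.
pose dF (p : R * 'rV[R]_m) := radial u p * radial u p + u (p.1 *: p.2) * radial2 u p.
have cF : continuous F by exact: continuous_mul.
have cdF : continuous dF by apply: continuous_add; exact: continuous_mul.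
have FdF (s : R) x : is_derive s 1 (fun s : R => F (s, x)) (dF (s, x)).
  have H1 := is_derive_radial s x (Ck2_Ck1 C2u).
  have H2 := is_derive_radial2 s x C2u.
  exact: is_derive_mulf H1 H2.
apply: is_derive_eq (is_derive_sint t cF cdF FdF) _.
rewrite /dF/= sintD//; first exact: continuous_mul (@crt t) (@crt t).
exact: continuous_mul (@cu t) (@cr2t t).
Qed.

Lemma mean_sqr_ge0 t : 0 <= mean_sqr t.
Proof. by apply: sint_ge0 => x; rewrite -expr2 sqr_ge0. Qed.

Lemma mean_radial_sqr_ge0 t : 0 <= mean_radial_sqr t.
Proof. by apply: sint_ge0 => x; rewrite -expr2 sqr_ge0. Qed.

(** Cauchy-Schwarz, by the discriminant of the integral of [(s u + u_r)^2] as a quadratic in [s]. *)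
Lemma mean_flux_sqr_le t : mean_flux t ^+ 2 <= mean_sqr t * mean_radial_sqr t.
Proof.
apply: discriminant_le (mean_sqr_ge0 t) _ => s.
have : 0 <= sint (fun x => (s * u (t *: x) + radial u (t, x)) ^+ 2).
  by apply: sint_ge0 => x; rewrite sqr_ge0.
rewrite (@eq_sint _ _ _ (fun x => (s ^+ 2 * (u (t *: x) * u (t *: x)) +
    2 * s * (u (t *: x) * radial u (t, x))) + radial u (t, x) * radial u (t, x))).
  have cc (c : R) f : continuous f -> continuous (fun x : 'rV[R]_m => c * f x).
    by move=> cf; apply: continuous_mul => //; exact: cst_continuous.
  rewrite sintD; [|apply: continuous_add; apply: cc; exact: continuous_mul|
                   exact: continuous_mul].
  by rewrite sintD ?sintZ//; do ?[apply: cc]; exact: continuous_mul.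
by move=> x _; move: (u _) (radial _ _) => a b; ring.
Qed.

(** Then [u_r] vanishes off the origin, so [u] is constant on each ray, and all rays share the value
    at the origin. Constancy is read off from monotonicity of both [u] and [- u]. *)
Lemma constant_of_mean_radial_sqr : (0 < m)%N ->
  (forall t, 0 < t -> mean_radial_sqr t <= 0) -> forall x, u x = u 0.
Proof.
move=> m0 Q0 x.
have rad0 t y : 0 < t -> enorm y = 1 -> radial u (t, y) = 0.
  move=> t0 y1; apply/eqP; rewrite -sqrf_eq0 expr2; apply/eqP.
  apply: (@sint_eq0 _ _ (fun y => radial u (t, y) * radial u (t, y)) m0) => //.
  - exact: continuous_mul.
  - by move=> z; rewrite -expr2 sqr_ge0.
  - by apply/eqP; rewrite eq_le Q0//= mean_radial_sqr_ge0.
have [x0|x0] := eqVneq (enorm x) 0.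
  congr u; apply/rowP => i; rewrite mxE; apply/eqP.
  by rewrite -normr_le0 -x0 coord_le_enorm.
have ex : 0 < enorm x by rewrite lt_neqAle eq_sym x0 enorm_ge0.
pose y := (enorm x)^-1 *: x.
have y1 : enorm y = 1 by rewrite enormZ ger0_norm ?invr_ge0 ?enorm_ge0// mulVf.
have xE : x = enorm x *: y by rewrite scalerA divff// scale1r.
have H (t : R) : is_derive t 1 (fun s : R => u (s *: y)) (radial u (t, y)).
  exact/is_derive_radial/Ck2_Ck1.
have le1 : u (0 *: y) <= u (enorm x *: y).
  apply: (ge0_derive_le (ltW ex) (fun t _ => H t)) => t /andP[t0 _].
  by rewrite rad0.
have le2 : -1 * u (0 *: y) <= -1 * u (enorm x *: y).
  apply: (ge0_derive_le (ltW ex) (fun t _ => is_derive_mulcl (-1) (H t))) => t.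
  by move=> /andP[t0 _]; rewrite rad0// mulr0.
apply/eqP; rewrite {1}xE -(scale0r y) eq_le le1 andbT.
by rewrite !mulN1r lerN2 in le2.
Qed.

End spherical_mean.

(** With the dimension written [k + 2], the exponent [m - 1] of [P] is [k + 1]; dividing
    [energy_inequality] by [2 t^2] produces the coefficient [t/2 - (m-1)/t]. *)
Lemma quasi_harmonic_growth (R : realType) (k : nat) (u : 'rV[R]_k.+2 -> R) :
  (0 < k)%N -> quasi_harmonic u -> ~ (forall x, u x = u 0) ->
  exists c a, [/\ 0 < c, 0 < a & forall t, a <= t ->
    c * (comparison k.+2 t - comparison k.+2 a) <= Num.sqrt (mean_sqr u t)].
Proof.
move=> k0 qu ncst; have [C2u _] := qu.
apply: (energy_growth (is_derive_mean_sqr C2u) (is_derive_mean_flux C2u)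
  (mean_sqr_ge0 u) (mean_radial_sqr_ge0 u) (mean_flux_sqr_le C2u)).
- move=> t t0; rewrite addrC lerD2l.
  have := @energy_inequality R k.+2 u t k0 qu; rewrite -/(mean_flux u t).
  move: (mean_flux u t) (sint _) => K S.
  have -> : k.+2%:R - 1 = k.+1%:R :> R by rewrite -natr1 addrK.
  move=> H.
  have -> : t / 2 - k.+1%:R / t = (t ^+ 3 - 2 * k.+1%:R * t) / (2 * t ^+ 2).
    by field; rewrite gt_eqF.
  by rewrite [leLHS]mulrAC ler_pdivrMr ?mulr_gt0 ?exprn_gt0// [S * _]mulrC.
- apply: contrapT => nQ; apply: ncst; apply: constant_of_mean_radial_sqr => // t t0.
  by rewrite leNgt; apply/negP => Qt; apply: nQ; exists t.
Qed.

Theorem theorem1p5 (R : realType) (m : nat) (u : 'rV[R]_m -> R)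
    (C eps : R) (r : nat -> R) :
  (3 <= m)%N ->
  quasi_harmonic u ->
  0 < C -> 0 < eps ->
  (forall i, 0 < r i) ->
  r @ \oo --> +oo ->
  (forall i,
    ((\int[@sphere_measure R m]_(theta in @unit_sphere R m)
        (u (r i *: row_of_tuple theta) ^+ 2)%:E) `^ 2^-1
     <= (C * expR (r i ^+ 2 / 4) * r i `^ (- (m%:R + eps)))%:E)%E) ->
  exists c : R, forall x : 'rV[R]_m, u x = c.
Proof.
case: m u => [|[|k]] u // k0 qu C0 eps0 r_gt0 r_oo Hr.
exists (u 0); apply: contrapT => ncst; have [C2u _] := qu.
have [c [a [c0 a0 growth]]] := quasi_harmonic_growth k0 qu ncst.
set B := comparison k.+2 in growth.
have B_gt0 t : 0 < t -> 0 < B t by move=> t0; rewrite divr_gt0 ?expR_gt0 ?exprn_gt0.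
have upper i : Num.sqrt (mean_sqr u (r i)) <= C * B (r i) * (r i `^ eps)^-1.
  have := Hr i.
  have -> : (\int[@sphere_measure R k.+2]_(theta in @unit_sphere R k.+2)
        (u (r i *: row_of_tuple theta) ^+ 2)%:E)%E = (mean_sqr u (r i))%:E.
    rewrite /mean_sqr /sint /Rintegral fineK.
      by apply: eq_integral => t _; rewrite expr2.
    apply: integrable_fin_num; first exact: measurable_unit_sphere.
    apply: (@integrable_sphere R k.+2 (fun x => u (r i *: x) * u (r i *: x))).
    have cs : continuous (fun x : 'rV[R]_k.+2 => r i *: x) by exact: scaler_continuous.
    by apply: continuous_mul; exact: continuous_comp_fun cs (Ck_continuous C2u).
  rewrite poweR_EFin lee_fin powR12_sqrt ?mean_sqr_ge0//.
  move=> /le_trans; apply.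
  have ri0 : r i != 0 by rewrite gt_eqF.
  have -> : r i `^ (- (k.+2%:R + eps)) = (r i ^+ k.+2)^-1 * (r i `^ eps)^-1.
    by rewrite powRN powRD ?ri0 ?implybT// powR_mulrn ?ltW// invfM.
  by rewrite /B /comparison !mulrA.
pose D : R := 4 ^+ k.+3 * k.+3`!%:R.
have D0 : 0 < D by rewrite mulr_gt0 ?exprn_gt0// ltr0n fact_gt0.
(* The four thresholds: [a] for the growth bound, 1 for [comparison_ge], the third for
   [B (r i) > 2 B a], the last for [C (r i)^(-eps) <= c / 2]. One radius beyond all of them is
   enough. *)
pose A := Num.max (Num.max a 1) (Num.max (2 * B a * D + 1) ((2 * C / c) `^ eps^-1)).
have [i Ai] : exists i, A <= r i.
  have [n _ /(_ n (leqnn n))] := (cvgryPge _).1 r_oo A; by exists n.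
have := Ai; rewrite !ge_max => /andP[/andP[ra r1] /andP[rB rC]].
have ri0 := r_gt0 i.
have Bi : 2 * B a < B (r i).
  apply: lt_le_trans (comparison_ge k.+2 r1); rewrite ltr_pdivlMr//.
  by apply: lt_le_trans rB; rewrite ltrDl.
have Ci : C * (r i `^ eps)^-1 <= c / 2.
  rewrite ler_pdivrMr ?powR_gt0// mulrC -ler_pdivrMr ?divr_gt0//.
  rewrite (_ : C / (c / 2) = ((2 * C / c) `^ eps^-1) `^ eps).
    by apply: ge0_ler_powR => //; rewrite ?nnegrE ?powR_ge0// ltW.
  rewrite -powRrM mulVf ?gt_eqF// powRr1; last by rewrite divr_ge0 ?mulr_ge0// ltW.
  by field; rewrite gt_eqF.
(* At this radius the lower bound [c (B (r i) - B a)] exceeds [(c/2) B (r i)], while the upper bound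
   does not. *)
have := le_trans (growth _ ra) (upper i).
rewrite mulrAC leNgt => /negP; apply.
apply: (@le_lt_trans _ _ (c / 2 * B (r i))); first by rewrite ler_pM2r// B_gt0.
rewrite -mulrA ltr_pM2l//; lra.
Qed.
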